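(* Let $\mathcal M$ and $\mathcal N$ be $\mathbb N$-manifolds of degree 2 corresponding to objects $(E_1,\tilde E,\phi_E)$ and $(F_1,\tilde F,\phi_F)$ of $\mathrm{VB2}$, with bodies $M$ and $N$, and let $\Psi=(\psi,\psi^\sharp)\colon\mathcal M\to\mathcal N$ be a morphism, with corresponding vector-bundle maps $\psi_1\colon E_1\to F_1$, $\tilde\psi\colon\tilde E\to\tilde F$ covering $\psi\colon M\to N$, and let $\psi_2\colon E_2=\ker\phi_E\to F_2=\ker\phi_F$ be the restriction of $\tilde\psi$. A point $c\in N$ is a regular value of $\Psi$ if and only if (a) $c$ is a regular value of $\psi\colon M\to N$, and (b) the maps $\psi_i\colon E_i|_{\psi^{-1}(c)}\to F_i|_c$, $i=1,2$, are fiberwise surjective. (Equivalently, for each $x\in\psi^{-1}(c)$, the maps $(\psi_i)_x^*\colon F_i^*|_c\to E_i^*|_x$, $i=1,2$, are injective.)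
   Context: Manifolds and vector bundles are smooth and real. **$\mathbb N$-manifolds.** An $\mathbb N$-manifold of degree 2 and dimension $m_0|m_1|m_2$ is a pair $\mathcal M=(M,C_{\mathcal M})$, where $M$ (the body) is an $m_0$-dimensional manifold and $C_{\mathcal M}$ is a sheaf of ($\mathbb N$-graded) graded-commutative algebras on $M$ such that every point of $M$ has an open neighbourhood $U$ with $C_{\mathcal M}|_U\cong C^\infty_U\otimes\wedge\mathbb R^{m_1}\otimes\mathrm S\,\mathbb R^{m_2}$ (sheafification), elements of $\mathbb R^{m_q}$ having degree $q$. A morphism $\mathcal M\to\mathcal N$ is a pair $(\psi,\psi^\sharp)$ with $\psi\colon M\to N$ smooth and $\psi^\sharp\colon C_{\mathcal N}\to\psi_*C_{\mathcal M}$ a morphism of sheaves of graded algebras. **$\mathrm{VB2}$.** Objects are triples $(E_1,\tilde E,\phi_E)$ with $E_1,\tilde E$ vector bundles over $M$ and $\phi_E\colon\tilde E\to\wedge^2E_1$ a surjective vector-bundle map over $\mathrm{id}_M$. The corresponding $\mathbb N$-manifold is $(M,C_{\mathcal M})$ with $C_{\mathcal M}=(\Gamma_{\wedge^\bullet E_1^*}\otimes\Gamma_{\mathrm S^\bullet\tilde E^*})/I$, $I$ generated by $1\otimes\phi_E^*(T)-T\otimes1$ for $T\in\Gamma_{\wedge^2E_1^*}$, so $(C_{\mathcal M})_1=\Gamma_{E_1^*}$ and $(C_{\mathcal M})_2=\Gamma_{\tilde E^*}$. Every morphism $(\psi,\psi^\sharp)$ between such $\mathbb N$-manifolds is given in degrees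 1 and 2 by the maps on sections dual to unique vector-bundle maps $\psi_1\colon E_1\to F_1$ and $\tilde\psi\colon\tilde E\to\tilde F$ covering $\psi$ with $\wedge^2\psi_1\circ\phi_E=\phi_F\circ\tilde\psi$; hence $\tilde\psi(\ker\phi_E)\subseteq\ker\phi_F$. **Tangent maps and regular values.** For $x\in M$, a homogeneous tangent vector is a linear map $X_x\colon C_{\mathcal M}|_x\to\mathbb R$ on the stalk, of degree $|X_x|$, with $X_x(fg)=X_x(f)g_0(x)+(-1)^{|X_x||f|}f_0(x)X_x(g)$ ($f_0$ the degree-zero component); these span $\mathcal T_x\mathcal M$. The tangent map $(d\Psi)_x\colon\mathcal T_x\mathcal M\to\mathcal T_{\psi(x)}\mathcal N$ is $(d\Psi)_x(X_x)(f)=X_x(\psi^\sharp f)$. A point $c\in N$ is a regular value of $\Psi$ if $(d\Psi)_x$ is onto for all $x\in M$ with $\psi(x)=c$. *)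

(* Defs.v *)
From HB Require Import structures.
From mathcomp Require Import all_boot all_order all_algebra.
From mathcomp Require Import all_classical all_reals all_analysis.
Import Order.TTheory GRing.Theory Num.Theory numFieldNormedType.Exports.

Set Implicit Arguments.
Unset Strict Implicit.
Unset Printing Implicit Defensive.

Local Open Scope classical_set_scope.
Local Open Scope ring_scope.

(* Convention: objects living on an open set [U] (smooth functions, sections of
   a bundle, ...) are total functions on the whole space, and only their values
   on [U] matter.  Likewise a sheaf is indexed by [set M], but only its values
   on open sets are ever constrained or used. *)

(* [f] is C^n on the open set [D]: all iterated partial derivatives of order at
   most [n] exist and are continuous on [D]. *)
Fixpoint Ck (R : realType) (m n : nat) (D : set 'rV[R]_m) (f : 'rV[R]_m -> R)
    : Prop :=
  (forall p, D p -> {for p, continuous f}) /\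
  match n with
  | 0 => True
  | n'.+1 => forall i : 'I_m,
      (forall p, D p -> derivable f p (delta_mx 0 i)) /\
      Ck n' D (fun p => 'D_(delta_mx 0 i) f p)
  end.

Definition smooth_rV (R : realType) (m : nat) (D : set 'rV[R]_m)
  (f : 'rV[R]_m -> R) : Prop := forall n, Ck n D f.

Record manifold (R : realType) (m : nat) := Manifold {
  msp :> topologicalType;
  _ : hausdorff_space msp;
  _ : @second_countable msp;
  cidx : Type;
  cdom : cidx -> set msp;
  chart : cidx -> msp -> 'rV[R]_m;
  cinv : cidx -> 'rV[R]_m -> msp;
  cdom_open : forall i, open (cdom i);
  cdom_cover : forall x, exists i, cdom i x;
  chart_open : forall i, open (chart i @` cdom i);
  chartK : forall i x, cdom i x -> cinv i (chart i x) = x;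
  chart_cont : forall i x, cdom i x -> {for x, continuous (chart i)};
  cinv_cont : forall i p, (chart i @` cdom i) p -> {for p, continuous (cinv i)};
  chart_smooth : forall i j (k : 'I_m),
    smooth_rV (chart i @` (cdom i `&` cdom j)) (fun p => chart j (cinv i p) 0 k)
}.

Definition smooth (R : realType) (m : nat) (M : manifold R m) (U : set M)
    (f : M -> R) : Prop :=
  forall i : cidx M, smooth_rV (chart i @` (cdom i `&` U)) (fun p => f (cinv i p)).

Definition smooth_map (R : realType) (m n : nat) (M : manifold R m)
    (N : manifold R n) (psi : M -> N) : Prop :=
  continuous psi /\
  forall (j : cidx N) (k : 'I_n),
    smooth (psi @^-1` cdom j) (fun x => chart j (psi x) 0 k).

(* Tangent vectors of a manifold at [x]: derivations of germs at [x] of smooth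
   functions.  Every such germ is represented by a total function [M -> R]. *)
Definition smooth_at (R : realType) (m : nat) (M : manifold R m) (x : M)
    (f : M -> R) : Prop :=
  exists U : set M, [/\ open U, U x & smooth U f].

Record is_derivation (R : realType) (m : nat) (M : manifold R m) (x : M)
    (D : (M -> R) -> R) : Prop := {
  der_germ : forall f g, smooth_at x f -> smooth_at x g ->
    (\forall y \near x, f y = g y) -> D f = D g;
  der_lin : forall (a : R) f g, smooth_at x f -> smooth_at x g ->
    D (fun y => a * f y + g y) = a * D f + D g;
  der_leibniz : forall f g, smooth_at x f -> smooth_at x g ->
    D (fun y => f y * g y) = D f * g x + f x * D g
}.

(* [c] is a regular value of [psi]: (d psi)_x : D |-> (f |-> D (f o psi)) maps
   T_x M onto T_(psi x) N for every x over c. *)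
Definition regular_value (R : realType) (m n : nat) (M : manifold R m)
    (N : manifold R n) (psi : M -> N) (c : N) : Prop :=
  forall x, psi x = c ->
  forall D', is_derivation (psi x) D' ->
  exists2 D, is_derivation x D &
    forall f, smooth_at (psi x) f -> D (fun y => f (psi y)) = D' f.

(* The smooth structure is given by an atlas of local trivialisations, i.e. of
   local frames with smooth transition functions. *)
Record vbundle (R : realType) (m : nat) (M : manifold R m) := VBundle {
  vrank : nat;
  fib :> M -> vectType R;
  vidx : Type;
  vdom : vidx -> set M;
  vframe : vidx -> forall x, vrank.-tuple (fib x);
  vdom_open : forall j, open (vdom j);
  vdom_cover : forall x, exists j, vdom j x;
  vframe_basis : forall j x, vdom j x -> basis_of fullv (vframe j x);
  vframe_smooth : forall i j (a b : 'I_vrank),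
    smooth (vdom i `&` vdom j)
      (fun x => coord (vframe i x) a (tnth (vframe j x) b))
}.

Definition dsection (R : realType) (m : nat) (M : manifold R m)
  (E : vbundle M) := forall x : M, 'Hom(E x, R^o).

(* [a] is an element of Γ_{E^*}(U), tested on the local frames of E. *)
Definition dsmooth (R : realType) (m : nat) (M : manifold R m)
    (E : vbundle M) (U : set M) (a : dsection E) : Prop :=
  forall (j : vidx E) (b : 'I_(vrank E)),
    smooth (vdom j `&` U) (fun x => a x (tnth (vframe j x) b)).

Definition vb_pull (R : realType) (m n : nat) (M : manifold R m)
    (N : manifold R n) (E : vbundle M) (F : vbundle N) (psi : M -> N)
    (h : forall x, 'Hom(E x, F (psi x))) (b : dsection F) : dsection E :=
  fun x => (b (psi x) \o h x)%VF.

Definition vb_smooth (R : realType) (m n : nat) (M : manifold R m)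
    (N : manifold R n) (E : vbundle M) (F : vbundle N) (psi : M -> N)
    (h : forall x, 'Hom(E x, F (psi x))) : Prop :=
  forall (i : vidx E) (j : vidx F) (a : 'I_(vrank F)) (b : 'I_(vrank E)),
    smooth (vdom i `&` psi @^-1` vdom j)
      (fun x => coord (vframe j (psi x)) a (h x (tnth (vframe i x) b))).

(* Second exterior power: v /\ w is identified with the linear map
   xi |-> xi(v) w - xi(w) v from V^* to V.  For xi, eta in V^* the pairing
   <xi /\ eta, T> is then eta (T xi). *)
Definition wedge (R : realType) (V : vectType R) (v w : V)
    : 'Hom('Hom(V, R^o), V) :=
  linfun (fun xi : 'Hom(V, R^o) => (xi v : R) *: w - (xi w : R) *: v).

Definition wedge2 (R : realType) (V : vectType R)
    : {vspace 'Hom('Hom(V, R^o), V)} :=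
  <<[seq wedge v w | v <- vbasis {:V}, w <- vbasis {:V}]>>%VS.

Definition dual_map (R : realType) (V W : vectType R) (h : 'Hom(V, W))
    : 'Hom('Hom(W, R^o), 'Hom(V, R^o)) :=
  linfun (fun eta : 'Hom(W, R^o) => (eta \o h)%VF).

(* restricted to [wedge2 V], this is /\^2 h *)
Definition wedge2_map (R : realType) (V W : vectType R) (h : 'Hom(V, W))
    (T : 'Hom('Hom(V, R^o), V)) : 'Hom('Hom(W, R^o), W) :=
  (h \o (T \o dual_map h))%VF.

Record VB2 (R : realType) (m : nat) (M : manifold R m) := MkVB2 {
  E1 : vbundle M;
  Et : vbundle M;
  phi : forall x, 'Hom(Et x, 'Hom('Hom(E1 x, R^o), E1 x));
  phi_onto : forall x, limg (phi x) = wedge2 (E1 x);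
  phi_smooth : forall (i : vidx E1) (j : vidx Et) (a : 'I_(vrank Et))
      (b c : 'I_(vrank E1)),
    smooth (vdom i `&` vdom j)
      (fun x => coord (vframe i x) c
         (phi x (tnth (vframe j x) a) (linfun (coord (vframe i x) b))))
}.

(* phi_E^*(a /\ b) *)
Definition phi_dual (R : realType) (m : nat) (M : manifold R m) (E : VB2 M)
    (a b : dsection (E1 E)) : dsection (Et E) :=
  fun x => linfun (fun e : Et E x => b x (phi E x e (a x))).

Record VB2_mor (R : realType) (m n : nat) (M : manifold R m) (N : manifold R n)
    (E : VB2 M) (F : VB2 N) (psi : M -> N) := MkVB2_mor {
  psi1 : forall x, 'Hom(E1 E x, E1 F (psi x));
  psit : forall x, 'Hom(Et E x, Et F (psi x));
  psi1_smooth : vb_smooth psi1;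
  psit_smooth : vb_smooth psit;
  psi_phi : forall x (e : Et E x),
    wedge2_map (psi1 x) (phi E x e) = phi F (psi x) (psit x e)
}.

Definition E2 (R : realType) (m : nat) (M : manifold R m) (E : VB2 M) (x : M)
  := subvs_of (lker (phi E x)).

(* The restriction of [psit] to the kernels; by [psi_phi] it takes values in
   lker (phi F (psi x)), on which [vsproj] is the identity. *)
Definition psi2 (R : realType) (m n : nat) (M : manifold R m) (N : manifold R n)
    (E : VB2 M) (F : VB2 N) (psi : M -> N) (h : VB2_mor E F psi) (x : M)
    : 'Hom(E2 E x, E2 F (psi x)) :=
  linfun (fun u : E2 E x => vsproj (lker (phi F (psi x))) (psit h x (vsval u))).

(* A sheaf of graded-commutative R-algebras.  An R-algebra is a (possibly zero:
   think of U = set0) ring with a structure morphism [gcst] from R, central by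
   [gcomm]; the grading is given by the projections [gcomp U k] onto the
   component of degree k, and it is in each degree that sections are glued. *)
Record gsheaf (R : realType) (M : topologicalType) := GSheaf {
  sec :> set M -> pzRingType;
  gcst : forall U, {rmorphism R -> sec U};
  gcomp : forall U, nat -> sec U -> sec U;
  res : forall U V, sec U -> sec V;
  gcompD : forall U k (f g : sec U), open U ->
    gcomp k (f + g) = gcomp k f + gcomp k g;
  gcompI : forall U k l (f : sec U), open U ->
    gcomp k (gcomp l f) = if k == l then gcomp l f else 0;
  gcomp_sum : forall U (f : sec U), open U ->
    exists n, f = \sum_(k < n) gcomp k f;
  gcompM : forall U k l (f g : sec U), open U ->
    gcomp k f = f -> gcomp l g = g -> gcomp (k + l) (f * g) = f * g;
  gcomp_cst : forall U (a : R), open U -> gcomp 0 (gcst U a) = gcst U a;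
  gcomm : forall U k l (f g : sec U), open U ->
    gcomp k f = f -> gcomp l g = g -> f * g = (-1) ^+ (k * l) * (g * f);
  resD : forall U V (f g : sec U), open U -> open V -> V `<=` U ->
    res V (f + g) = res V f + res V g;
  resM : forall U V (f g : sec U), open U -> open V -> V `<=` U ->
    res V (f * g) = res V f * res V g;
  res_cst : forall U V (a : R), open U -> open V -> V `<=` U ->
    res V (gcst U a) = gcst V a;
  res_gcomp : forall U V k (f : sec U), open U -> open V -> V `<=` U ->
    res V (gcomp k f) = gcomp k (res V f);
  res_id : forall U (f : sec U), open U -> res U f = f;
  res_comp : forall U V W (f : sec U), open U -> open V -> open W ->
    V `<=` U -> W `<=` V -> res W (res V f) = res W f;
  res_sep : forall U (f g : sec U), open U ->
    (forall x, U x -> exists V, [/\ open V, V x, V `<=` U & res V f = res V g]) ->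
    f = g;
  res_glue : forall (I : Type) (D : I -> set M) (k : nat)
      (f : forall i, sec (D i)),
    (forall i, open (D i)) -> (forall i, gcomp k (f i) = f i) ->
    (forall i j, res (D i `&` D j) (f i) = res (D i `&` D j) (f j)) ->
    exists g : sec (\bigcup_i D i),
      gcomp k g = g /\ forall i, res (D i) g = f i
}.

Definition ghom (R : realType) (M : topologicalType) (C : gsheaf R M)
  (U : set M) (k : nat) (f : C U) : Prop := gcomp k f = f.

Definition monom (A : pzRingType) (m1 m2 k : nat) (xi : 'I_m1 -> A)
    (eta : 'I_m2 -> A) (I : {set 'I_m1}) (al : {ffun 'I_m2 -> 'I_k.+1}) : A :=
  (\prod_(i in I) xi i) * \prod_a eta a ^+ al a.

Definition mdeg (m1 m2 k : nat) (I : {set 'I_m1})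
    (al : {ffun 'I_m2 -> 'I_k.+1}) : nat :=
  (#|I| + 2 * \sum_a al a)%N.

(* An N-manifold of dimension m0|m1|m2 with body M.  The first group of axioms
   after [nval] says that [nval] identifies the sheaf of degree 0 components
   with the sheaf of smooth functions on M; it is only used in degree 0.
   [n_local] is the local form C^oo_U (x) /\ R^m1 (x) S R^m2: over U, every
   section of degree k is uniquely a combination of the monomials of degree k in
   generators xi (degree 1) and eta (degree 2), with coefficients of degree 0;
   the product is determined by graded commutativity. *)
Record Nmanifold (R : realType) (m0 : nat) (M : manifold R m0) (m1 m2 : nat) :=
  MkNmanifold {
  nsheaf :> gsheaf R M;
  nval : forall U, nsheaf U -> M -> R;
  nvalD : forall U (f g : nsheaf U) x, open U -> U x -> ghom 0 f -> ghom 0 g ->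
    nval (f + g) x = nval f x + nval g x;
  nvalM : forall U (f g : nsheaf U) x, open U -> U x -> ghom 0 f -> ghom 0 g ->
    nval (f * g) x = nval f x * nval g x;
  nval_cst : forall U (a : R) x, open U -> U x -> nval (gcst nsheaf U a) x = a;
  nval_res : forall U V (f : nsheaf U) x, open U -> open V -> V `<=` U -> V x ->
    ghom 0 f -> nval (res V f) x = nval f x;
  nval_smooth : forall U (f : nsheaf U), open U -> ghom 0 f -> smooth U (nval f);
  nval_inj : forall U (f g : nsheaf U), open U -> ghom 0 f -> ghom 0 g ->
    (forall x, U x -> nval f x = nval g x) -> f = g;
  nval_surj : forall U (h : M -> R), open U -> smooth U h ->
    exists f : nsheaf U, ghom 0 f /\ forall x, U x -> nval f x = h x;
  n_local : forall x : M, exists U : set M, exists xi : 'I_m1 -> nsheaf U,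
    exists eta : 'I_m2 -> nsheaf U,
    [/\ open U, U x, (forall i, ghom 1 (xi i)), (forall a, ghom 2 (eta a)) &
     forall V k, open V -> V `<=` U ->
     let comb (c : {set 'I_m1} -> {ffun 'I_m2 -> 'I_k.+1} -> nsheaf V) :=
       \sum_I \sum_(al | mdeg I al == k) c I al * res V (monom xi eta I al) in
     (forall f : nsheaf V, ghom k f ->
        exists2 c, (forall I al, ghom 0 (c I al)) & f = comb c) /\
     (forall c c', (forall I al, ghom 0 (c I al) /\ ghom 0 (c' I al)) ->
        comb c = comb c' -> forall I al, mdeg I al = k -> c I al = c' I al)]
}.

Record Nmor (R : realType) (m0 m1 m2 n0 n1 n2 : nat) (M : manifold R m0)
    (N : manifold R n0) (CM : Nmanifold M m1 m2) (CN : Nmanifold N n1 n2) :=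
  MkNmor {
  nbase : M -> N;
  nbase_smooth : smooth_map nbase;
  npull : forall V, CN V -> CM (nbase @^-1` V);
  npullD : forall V (f g : CN V), open V ->
    npull (f + g) = npull f + npull g;
  npullM : forall V (f g : CN V), open V ->
    npull (f * g) = npull f * npull g;
  npull_cst : forall V (a : R), open V ->
    npull (gcst CN V a) = gcst CM (nbase @^-1` V) a;
  npull_gcomp : forall V k (f : CN V), open V ->
    npull (gcomp k f) = gcomp k (npull f);
  npull_res : forall V W (f : CN V), open V -> open W -> W `<=` V ->
    npull (res W f) = res (nbase @^-1` W) (npull f)
}.

(* A linear map on the stalk at x, i.e. on the colimit of the C(U) over the open
   neighbourhoods U of x, is a family of linear maps X U : C(U) -> R compatible
   with restrictions.  It has degree p when it sends elements of degree k to
   degree k + p, R being concentrated in degree 0. *)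
Record is_htangent (R : realType) (m0 m1 m2 : nat) (M : manifold R m0)
    (CM : Nmanifold M m1 m2) (x : M) (p : int)
    (X : forall U : set M, CM U -> R) : Prop := {
  ht_lin : forall U (a : R) (f g : CM U), open U -> U x ->
    X U (gcst CM U a * f + g) = a * X U f + X U g;
  ht_res : forall U V (f : CM U), open U -> open V -> V `<=` U -> V x ->
    X V (res V f) = X U f;
  ht_deg : forall U k (f : CM U), open U -> U x -> ghom k f ->
    k%:Z + p != 0 -> X U f = 0;
  ht_leibniz : forall U k (f g : CM U), open U -> U x -> ghom k f ->
    X U (f * g) = X U f * nval (gcomp 0 g) x
                  + (-1) ^ (p * k%:Z) * nval (gcomp 0 f) x * X U g
}.

(* the span of the homogeneous tangent vectors at x *)
Definition is_tangent (R : realType) (m0 m1 m2 : nat) (M : manifold R m0)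
    (CM : Nmanifold M m1 m2) (x : M) (X : forall U : set M, CM U -> R) : Prop :=
  exists (n : nat) (p : 'I_n -> int) (Y : 'I_n -> forall U : set M, CM U -> R),
    (forall i, is_htangent x (p i) (Y i)) /\
    forall U (f : CM U), open U -> U x -> X U f = \sum_i Y i U f.

Definition Nregular_value (R : realType) (m0 m1 m2 n0 n1 n2 : nat)
    (M : manifold R m0) (N : manifold R n0) (CM : Nmanifold M m1 m2)
    (CN : Nmanifold N n1 n2) (Psi : Nmor CM CN) (c : N) : Prop :=
  forall x, nbase Psi x = c ->
  forall Y : (forall V : set N, CN V -> R), is_tangent (nbase Psi x) Y ->
  exists2 X : (forall U : set M, CM U -> R), is_tangent x X &
    forall V (f : CN V), open V -> V (nbase Psi x) ->
      X (nbase Psi @^-1` V) (npull Psi f) = Y V f.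

(* Γ_{/\E1^*} (x) Γ_{S Et^*} is the free graded-commutative algebra over smooth
   functions generated by Γ_{E1^*} in degree 1 and Γ_{Et^*} in degree 2.  Over
   U, its quotient by the ideal I is presented as the set of algebraic
   expressions in the generators modulo the congruence [teq U]. *)
Inductive term (R : realType) (m : nat) (M : manifold R m) (E : VB2 M) : Type :=
| Tfun of (M -> R)
| Tone of dsection (E1 E)
| Ttwo of dsection (Et E)
| Tadd of term E & term E
| Topp of term E
| Tmul of term E & term E.

Arguments Tfun {R m M E}.
Arguments Tone {R m M E}.
Arguments Ttwo {R m M E}.

Fixpoint tsmooth (R : realType) (m : nat) (M : manifold R m) (E : VB2 M)
    (U : set M) (t : term E) : Prop :=
  match t with
  | Tfun f => smooth U f
  | Tone a => dsmooth U a
  | Ttwo b => dsmooth U b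
  | Tadd t1 t2 | Tmul t1 t2 => tsmooth U t1 /\ tsmooth U t2
  | Topp t1 => tsmooth U t1
  end.

Inductive teq (R : realType) (m : nat) (M : manifold R m) (E : VB2 M)
    (U : set M) : term E -> term E -> Prop :=
| teq_refl t : teq U t t
| teq_sym t u : teq U t u -> teq U u t
| teq_trans t u v : tsmooth U u -> teq U t u -> teq U u v -> teq U t v
| teq_add t t' u u' : teq U t t' -> teq U u u' -> teq U (Tadd t u) (Tadd t' u')
| teq_opp t t' : teq U t t' -> teq U (Topp t) (Topp t')
| teq_mul t t' u u' : teq U t t' -> teq U u u' -> teq U (Tmul t u) (Tmul t' u')
(* sections over U are determined by their values on U *)
| teq_fun_ext f g : (forall x, U x -> f x = g x) -> teq U (Tfun f) (Tfun g)
| teq_one_ext a b : (forall x, U x -> a x = b x) -> teq U (Tone a) (Tone b)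
| teq_two_ext a b : (forall x, U x -> a x = b x) -> teq U (Ttwo a) (Ttwo b)
| teq_addA t u v : teq U (Tadd t (Tadd u v)) (Tadd (Tadd t u) v)
| teq_addC t u : teq U (Tadd t u) (Tadd u t)
| teq_add0 t : teq U (Tadd (Tfun (fun=> 0)) t) t
| teq_addN t : teq U (Tadd (Topp t) t) (Tfun (fun=> 0))
| teq_mulA t u v : teq U (Tmul t (Tmul u v)) (Tmul (Tmul t u) v)
| teq_mul1 t : teq U (Tmul (Tfun (fun=> 1)) t) t
| teq_mulDl t u v : teq U (Tmul (Tadd t u) v) (Tadd (Tmul t v) (Tmul u v))
| teq_mulDr t u v : teq U (Tmul t (Tadd u v)) (Tadd (Tmul t u) (Tmul t v))
| teq_funD f g : teq U (Tfun (fun x => f x + g x)) (Tadd (Tfun f) (Tfun g))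
| teq_funM f g : teq U (Tfun (fun x => f x * g x)) (Tmul (Tfun f) (Tfun g))
| teq_funC f t : teq U (Tmul (Tfun f) t) (Tmul t (Tfun f))
| teq_oneD a b : teq U (Tone (fun x => a x + b x)) (Tadd (Tone a) (Tone b))
| teq_oneZ f a : teq U (Tone (fun x => f x *: a x)) (Tmul (Tfun f) (Tone a))
| teq_twoD a b : teq U (Ttwo (fun x => a x + b x)) (Tadd (Ttwo a) (Ttwo b))
| teq_twoZ f a : teq U (Ttwo (fun x => f x *: a x)) (Tmul (Tfun f) (Ttwo a))
(* With [teq_funC] this gives the graded tensor product of the exterior algebra
   (odd generators square to zero) and the symmetric algebra. *)
| teq_ext a : teq U (Tmul (Tone a) (Tone a)) (Tfun (fun=> 0))
| teq_twoC b t : teq U (Tmul (Ttwo b) t) (Tmul t (Ttwo b))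
(* the ideal I: phi_E^*(a /\ b) = a b *)
| teq_phi a b : teq U (Ttwo (phi_dual a b)) (Tmul (Tone a) (Tone b)).

Definition fun_sec (R : realType) (m0 m1 m2 : nat) (M : manifold R m0)
    (CM : Nmanifold M m1 m2) (U : set M) (f : M -> R) : CM U :=
  xget 0 [set s : CM U | ghom 0 s /\ forall x, U x -> nval s x = f x].

Section Eval.
Context (R : realType) (m0 m1 m2 : nat) (M : manifold R m0) (E : VB2 M).
Context (CM : Nmanifold M m1 m2) (U : set M).
Context (j1 : dsection (E1 E) -> CM U) (j2 : dsection (Et E) -> CM U).

Fixpoint teval (t : term E) : CM U :=
  match t with
  | Tfun f => fun_sec CM U f
  | Tone a => j1 a
  | Ttwo b => j2 b
  | Tadd t1 t2 => teval t1 + teval t2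
  | Topp t1 => - teval t1
  | Tmul t1 t2 => teval t1 * teval t2
  end.

End Eval.

(* [CM] is the N-manifold corresponding to [E]: the inclusions of the generators
   exhibit its sheaf as the (sheafified) quotient of
   Γ_{/\E1^*} (x) Γ_{S Et^*} by I, i.e. the map from the presheaf of terms is
   locally surjective and its kernel is, locally, the congruence [teq].  In
   [teq_trans] the middle term is required to be smooth so that a derivation
   between smooth terms only goes through smooth terms. *)
Record corresponds (R : realType) (m0 m1 m2 : nat) (M : manifold R m0)
    (CM : Nmanifold M m1 m2) (E : VB2 M) := MkCorresponds {
  j1 : forall U, dsection (E1 E) -> CM U;
  j2 : forall U, dsection (Et E) -> CM U;
  j1_deg : forall U a, open U -> dsmooth U a -> ghom 1 (j1 U a);
  j2_deg : forall U b, open U -> dsmooth U b -> ghom 2 (j2 U b);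
  j1_res : forall U V a, open U -> open V -> V `<=` U -> dsmooth U a ->
    res V (j1 U a) = j1 V a;
  j2_res : forall U V b, open U -> open V -> V `<=` U -> dsmooth U b ->
    res V (j2 U b) = j2 V b;
  j_onto : forall U (f : CM U) x, open U -> U x ->
    exists V, [/\ open V, V x, V `<=` U &
      exists2 t : term E, tsmooth V t & res V f = teval (j1 V) (j2 V) t];
  j_ker : forall U (t u : term E), open U -> tsmooth U t -> tsmooth U u ->
    teval (j1 U) (j2 U) t = teval (j1 U) (j2 U) u <->
    (forall x, U x -> exists V, [/\ open V, V x, V `<=` U & teq V t u])
}.

(* In degrees 1 and 2, the pullback of Psi is a |-> a o psi1, b |-> b o psit. *)
Definition given_by (R : realType) (m0 m1 m2 n0 n1 n2 : nat)
    (M : manifold R m0) (N : manifold R n0) (CM : Nmanifold M m1 m2)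
    (CN : Nmanifold N n1 n2) (E : VB2 M) (F : VB2 N) (cE : corresponds CM E)
    (cF : corresponds CN F) (Psi : Nmor CM CN) (h : VB2_mor E F (nbase Psi))
    : Prop :=
  (forall V (a : dsection (E1 F)), open V -> dsmooth V a ->
     dsmooth (nbase Psi @^-1` V) (vb_pull (psi1 h) a) /\
     npull Psi (j1 cF V a) = j1 cE (nbase Psi @^-1` V) (vb_pull (psi1 h) a)) /\
  (forall V (b : dsection (Et F)), open V -> dsmooth V b ->
     dsmooth (nbase Psi @^-1` V) (vb_pull (psit h) b) /\
     npull Psi (j2 cF V b) = j2 cE (nbase Psi @^-1` V) (vb_pull (psit h) b)).

(* Main.v *)
(* A homogeneous tangent vector at x, of whatever degree, is an ordinary point
   derivation of the stalk at x, since the factors deciding the sign in the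
   Leibniz rule vanish at x unless their degree is 0.  A point derivation is
   determined by its values on functions and on sections of E_1^* and Et^*: a
   derivation D of smooth functions, a vector v in E_1|_x and a vector u in Et|_x,
   and killing the products a b = phi_E^*(a /\ b) forces u to lie in ker phi_E.
   Conversely every such triple comes from a tangent vector, as one sees from the
   quotient of the algebra by its part of degree at least 3.  In these terms the
   tangent map of Psi is d psi + psi_1 + psi_2, and it is onto if and only if each
   of the three summands is. *)
Require Import Defs.
From HB Require Import structures.
From mathcomp Require Import all_boot all_order all_algebra.
From mathcomp Require Import all_classical all_reals all_analysis.
From mathcomp Require Import ring.
Import Order.TTheory GRing.Theory Num.Theory numFieldNormedType.Exports.

Set Implicit Arguments.
Unset Strict Implicit.
Unset Printing Implicit Defensive.
Local Open Scope classical_set_scope.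
Local Open Scope ring_scope.

(** * Smooth functions *)

(** The sheaf is known only through local terms modulo a congruence, so the tangent vector attached
    to a triple $(D,v,u)$ has to be computed on a term representing the germ, and the work lies in
    the independence of that term. Instead of forming a quotient algebra, the parts of degree 0, 1
    and 2 of a term are computed by recursion and shown to be invariant under every relation. Higher
    degrees may be cut off because a point derivation kills every product of two factors of positive
    degree. The summands $D$, $v$, $u$ have degrees 0, $-1$, $-2$, so their sum lies in the span of
    homogeneous tangent vectors. This is derived from the fact that the pullback is a unital
    morphism of algebras. *)

Lemma Ck_cont (R : realType) m n (D : set 'rV[R]_m) f :
  Ck n D f -> forall p, D p -> {for p, continuous f}.
Proof. by case: n => [|n] []. Qed.

Lemma Ck_W (R : realType) m n (D : set 'rV[R]_m) f : Ck n.+1 D f -> Ck n D f.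
Proof.
elim: n f => [|n IH] f; first by case.
by move=> [cf df]; split=> // i; have [d1 d2] := df i; split=> //; exact: IH.
Qed.

(** Continuity and derivatives at a point are those of the total function [f], even when they look
    outside [D]. Smoothness can therefore be restricted and localised along arbitrary sets, open or
    not. *)
Lemma Ck_pointwise (R : realType) m n (D : set 'rV[R]_m) f :
  Ck n D f <-> forall p, D p -> Ck n [set p] f.
Proof.
elim: n f => [|n IH] f.
  split=> [[cf _] p Dp|H]; first by split=> // _ ->; exact: cf.
  by split=> // p Dp; have [cf _] := H p Dp; exact: cf.
split=> [[cf df] p Dp|H].
  split=> [_ -> |i]; first exact: cf.
  have [d1 d2] := df i; split=> [_ ->|]; first exact: d1.
  exact: (IH _).1.
split=> [p Dp|i]; first by have [cf _] := H p Dp; exact: cf.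
split=> [p Dp|]; first by have [_ /(_ i)[d1 _]] := H p Dp; exact: d1.
by apply/IH => p Dp; have [_ /(_ i)[_ d2]] := H p Dp.
Qed.

Lemma Ck_ext (R : realType) m n (D : set 'rV[R]_m) (f g : 'rV[R]_m -> R) :
  open D -> (forall p, D p -> f p = g p) -> Ck n D f -> Ck n D g.
Proof.
move=> oD; elim: n f g => [|n IH] f g fg.
all: have nfg p : D p -> \forall q \near p, f q = g q
  by move=> Dp; apply: filterS fg _; exact: open_nbhs_nbhs.
all: have cfg : (forall p, D p -> {for p, continuous f}) ->
      forall p, D p -> {for p, continuous g}
  by move=> cf p Dp; change (g @ p --> g p); rewrite -(fg p Dp);
     apply: cvg_trans (cf p Dp); exact: near_eq_cvg (nfg p Dp).
  by move=> [cf _]; split=> //; exact: cfg.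
move=> [cf df]; split; first exact: cfg.
move=> i; have [d1 d2] := df i; split=> [p Dp|].
  exact: (near_eq_derivable (nfg p Dp) (d1 p Dp)).
apply: IH d2 => p Dp; exact: near_eq_derive (nfg p Dp).
Qed.

Lemma Ck_cst (R : realType) m n (D : set 'rV[R]_m) (a : R) :
  Ck n D (fun=> a).
Proof.
elim: n a => [|n IH] a; split=> //;
  do ?[by move=> p _; exact: cst_continuous]; move=> i.
split=> [p _|]; first exact: derivable_cst.
have -> : (fun p : 'rV[R]_m => 'D_(delta_mx 0 i) (fun=> a) p) = (fun=> 0)
  by apply/funext => p; exact: derive_cst.
exact: IH.
Qed.

Lemma Ck_add (R : realType) m n (D : set 'rV[R]_m) (f g : 'rV[R]_m -> R) :
  open D -> Ck n D f -> Ck n D g -> Ck n D (fun p => f p + g p).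
Proof.
move=> oD; elim: n f g => [|n IH] f g [cf df] [cg dg].
  by split=> // p Dp; apply: continuousD; [exact: cf|exact: cg].
split=> [p Dp|i]; first by apply: continuousD; [exact: cf|exact: cg].
have [[df1 df2] [dg1 dg2]] := (df i, dg i).
split=> [p Dp|]; first by apply: derivableD; [exact: df1|exact: dg1].
apply: Ck_ext (IH _ _ df2 dg2) => // p Dp.
by rewrite -(deriveD (df1 _ Dp) (dg1 _ Dp)).
Qed.

Lemma Ck_mul (R : realType) m n (D : set 'rV[R]_m) (f g : 'rV[R]_m -> R) :
  open D -> Ck n D f -> Ck n D g -> Ck n D (fun p => f p * g p).
Proof.
move=> oD; elim: n f g => [|n IH] f g Cf Cg; have [cf df] := Cf; have [cg dg] := Cg.
  by split=> // p Dp; apply: continuousM; [exact: cf|exact: cg].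
split=> [p Dp|i]; first by apply: continuousM; [exact: cf|exact: cg].
have [[df1 df2] [dg1 dg2]] := (df i, dg i).
split=> [p Dp|]; first by apply: derivableM; [exact: df1|exact: dg1].
apply: Ck_ext (Ck_add oD (IH _ _ (Ck_W Cf) dg2) (IH _ _ (Ck_W Cg) df2)) => // p Dp.
by rewrite -(deriveM (df1 _ Dp) (dg1 _ Dp)).
Qed.

Lemma Ck_inv (R : realType) m n (D : set 'rV[R]_m) (f : 'rV[R]_m -> R) :
  open D -> (forall p, D p -> f p != 0) -> Ck n D f -> Ck n D (fun p => (f p)^-1).
Proof.
move=> oD f0; elim: n => [|n IH] Cf; have [cf df] := Cf.
  by split=> // p Dp; apply: continuousV; [exact: f0|exact: cf].
split=> [p Dp|i]; first by apply: continuousV; [exact: f0|exact: cf].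
have [df1 df2] := df i; have Ci := IH (Ck_W Cf).
split=> [p Dp|]; first by apply: derivableV; [exact: f0|exact: df1].
(* The partial derivative of $1/f$ is $-(1/f)(1/f)f'$, where $1/f$ is $C^n$ by induction. *)
apply: Ck_ext (Ck_mul oD (Ck_cst _ _ (-1)) (Ck_mul oD (Ck_mul oD Ci Ci) df2)) => //.
move=> p Dp; rewrite (deriveV (f0 _ Dp) (df1 _ Dp)) mulN1r -exprVn expr2 scaleNr.
by [].
Qed.

(** * Smooth functions on a manifold *)

Section Smooth.
Context (R : realType) (m : nat) (M : manifold R m).
Implicit Types (U V : set M) (f g : M -> R).

Lemma chart_image_open i U : open U -> open (@chart R m M i @` (cdom i `&` U)).
Proof.
move=> oU.
(* The image is the part of the chart range that [cinv i] sends into [U], and [cinv i] is continuous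
   on that range. *)
rewrite (_ : _ @` _ = (chart i @` cdom i) `&` (cinv i @^-1` U)); last first.
  apply/seteqP; split=> p /=.
    move=> [x [dx Ux] <-]; split; first by exists x.
    by rewrite chartK.
  by move=> [[x dx <-]]; rewrite chartK // => Ux; exists x.
rewrite openE => p [cp Up]; rewrite /interior; apply: filterI.
  by apply: open_nbhs_nbhs; split=> //; exact: chart_open.
by apply: (cinv_cont cp); exact: open_nbhs_nbhs.
Qed.

Lemma smoothP U f : smooth U f <->
  forall i n y, U y -> @cdom R m M i y -> Ck n [set chart i y] (fun p => f (cinv i p)).
Proof.
split=> [sf i n y Uy cy|H i n].
  by apply: ((Ck_pointwise _ _ _).1 (sf i n)); exists y.
by apply/Ck_pointwise => _ [y [cy Uy] <-]; exact: H.
Qed.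

Lemma smooth_sub U V f : V `<=` U -> smooth U f -> smooth V f.
Proof. by move=> VU /smoothP H; apply/smoothP => i n y /VU; exact: H. Qed.

Lemma smooth_local U f :
  (forall x, U x -> exists2 V, V x & smooth (U `&` V) f) -> smooth U f.
Proof.
move=> H; apply/smoothP => i n y Uy cy; have [V Vy /smoothP] := H y Uy.
exact.
Qed.

Lemma smooth_ext U f g : open U -> (forall x, U x -> f x = g x) ->
  smooth U f -> smooth U g.
Proof.
move=> oU fg sf i n; apply: Ck_ext (sf i n); first exact: chart_image_open.
by move=> _ [x [cx Ux] <-]; rewrite chartK // fg.
Qed.

Lemma smooth_cst U (a : R) : smooth U (fun=> a).
Proof. by move=> i n; exact: Ck_cst. Qed.

Lemma smooth_add U f g : open U -> smooth U f -> smooth U g ->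
  smooth U (fun x => f x + g x).
Proof.
move=> oU sf sg i n.
exact: (Ck_add (chart_image_open oU) (sf i n) (sg i n)).
Qed.

Lemma smooth_mul U f g : open U -> smooth U f -> smooth U g ->
  smooth U (fun x => f x * g x).
Proof.
move=> oU sf sg i n.
exact: (Ck_mul (chart_image_open oU) (sf i n) (sg i n)).
Qed.

Lemma smooth_opp U f : open U -> smooth U f -> smooth U (fun x => - f x).
Proof.
move=> oU sf.
apply: smooth_ext (smooth_mul oU (smooth_cst U (-1)) sf) => // x _.
by rewrite mulN1r.
Qed.

Lemma smooth_sum U (I : Type) (r : seq I) (f : I -> M -> R) : open U ->
  (forall i, smooth U (f i)) -> smooth U (fun x => \sum_(i <- r) f i x).
Proof.
move=> oU sf; elim: r => [|i r IH].
  apply: smooth_ext (smooth_cst U 0) => // x _; by rewrite big_nil.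
apply: smooth_ext (smooth_add oU (sf i) IH) => // x _.
by rewrite big_cons.
Qed.

Lemma smooth_inv U f : open U -> (forall x, U x -> f x != 0) -> smooth U f ->
  smooth U (fun x => (f x)^-1).
Proof.
move=> oU f0 sf i n.
apply: (Ck_inv (chart_image_open oU) _ (sf i n)).
by move=> _ [x [cx Ux] <-]; rewrite chartK //; exact: f0.
Qed.

Lemma smooth_cont U f : open U -> smooth U f ->
  forall x, U x -> {for x, continuous f}.
Proof.
move=> oU sf x Ux; have [i cx] := @cdom_cover R m M x.
have ci : (chart i @` (cdom i `&` U)) (chart i x) by exists x.
have := Ck_cont (sf i 0) ci.
rewrite /prop_for /continuous_at chartK // => fc.
have := cvg_comp _ _ (chart_cont cx) fc.
apply: cvg_trans; apply: near_eq_cvg.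
have : nbhs x (cdom i) by apply: open_nbhs_nbhs; split=> //; exact: cdom_open.
by apply: filterS => y cy /=; rewrite chartK.
Qed.

End Smooth.

(** * Linear algebra and dual sections *)

Section LinearAlgebra.
Context (R : realType).
Implicit Types V W : vectType R.

(** [linfun] accepts any function; linearity is packed into a structure here so that forms given by
    explicit formulas can be evaluated. *)
Lemma linfunE V W (f : V -> W) : linear f -> linfun f =1 f.
Proof.
move=> fl; pose fM := GRing.isLinear.Build _ _ _ _ _ fl.
pose fL : {linear V -> W} := HB.pack f fM.
exact: (lfunE fL).
Qed.

(** Values of forms are read in [R] rather than [R^o] here, so that [ring] applies to them. *)
Lemma formD V (l l' : 'Hom(V, R^o)) v : (l + l') v = (l v : R) + (l' v : R) :> R.
Proof. exact: add_lfunE. Qed.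

Lemma formZ V (k : R) (l : 'Hom(V, R^o)) v : (k *: l) v = k * (l v : R) :> R.
Proof. exact: scale_lfunE. Qed.

Lemma eq_form V (l l' : 'Hom(V, R^o)) : (forall v, l v = l' v :> R) -> l = l'.
Proof. by move=> H; apply/lfunP. Qed.

Lemma dual_mapE V W (h : 'Hom(V, W)) eta : dual_map h eta = (eta \o h)%VF.
Proof.
rewrite /dual_map linfunE // => k u v; apply/lfunP => w.
by rewrite !(comp_lfunE, add_lfunE, scale_lfunE).
Qed.

Lemma wedgeE V (v w : V) (xi : 'Hom(V, R^o)) :
  wedge v w xi = (xi v : R) *: w - (xi w : R) *: v.
Proof.
rewrite /wedge linfunE // => k a b.
rewrite !(add_lfunE, scale_lfunE) !scalerDl !scalerDr -!scalerA opprD.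
by rewrite scalerN addrACA.
Qed.

(** The left side is the pairing of $a\wedge a$ with $T$; on a generator $v\wedge w$ it is
    $a(v)a(w)-a(w)a(v)$. *)
Lemma wedge2_alt V (T : 'Hom('Hom(V, R^o), V)) (a : 'Hom(V, R^o)) :
  T \in wedge2 V -> a (T a) = 0.
Proof.
rewrite /wedge2; set X := [seq _ | v <- _, w <- _] => TX.
have {TX} /coord_span -> : T \in <<in_tuple X>>%VS by [].
rewrite sum_lfunE linear_sum big1 //= => i _; rewrite scale_lfunE linearZ /=.
have /allpairsP[[v w] [_ _ ->]] : X`_i \in X by exact: mem_nth.
rewrite wedgeE linearB !linearZ /= scalerN.
by rewrite (_ : a v *: a w = a w *: a v) ?subrr ?scaler0 //; exact: mulrC.
Qed.

Lemma separating_dual V (v : V) : (forall l : 'Hom(V, R^o), l v = 0) -> v = 0.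
Proof.
move=> H; rewrite (coord_vbasis (memvf v)) big1 // => i _.
by have := H (linfun (coord (vbasis {:V}) i)); rewrite lfunE /= => ->; rewrite scale0r.
Qed.

Lemma surjective_dual_map V W (h : 'Hom(V, W)) :
  (forall w, exists v, h v = w) <-> injective (dual_map h).
Proof.
split=> [hs l l' |hi w].
  rewrite !dual_mapE => /lfunP ll'; apply/lfunP => w; have [v <-] := hs w.
  by have := ll' v; rewrite !comp_lfunE.
suff /memv_imgP[v _ ->] : w \in limg h by exists v.
suff -> : w = projv (limg h) w by exact: memv_proj.
apply/eqP; rewrite -subr_eq0; apply/eqP/separating_dual => l.
(* This form vanishes on the image of [h], so its pullback is zero and injectivity makes the form
   itself zero. *)
suff : (l \o (\1 - projv (limg h)))%VF = 0.
  by move=> /lfunP/(_ w); rewrite comp_lfunE add_lfunE opp_lfunE id_lfunE zero_lfunE.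
apply: hi; rewrite !dual_mapE; apply/lfunP => v.
rewrite !(comp_lfunE, add_lfunE, opp_lfunE, id_lfunE, zero_lfunE).
by rewrite projv_id ?memv_img ?memvf // subrr linear0.
Qed.

End LinearAlgebra.

(** * Smooth sections of dual bundles and the truncation of terms *)

Section DualSections.
Context (R : realType) (m : nat) (M : manifold R m).

Section Bundle.
Context (E : vbundle M).
Implicit Types (U V : set M) (a s : dsection E).

Definition dframe (j : vidx E) (b : 'I_(vrank E)) : dsection E :=
  fun x => linfun (coord (vframe j x) b).

Lemma dframeE j b x v : dframe j b x v = coord (vframe j x) b v.
Proof. by rewrite /dframe lfunE. Qed.

Lemma vframe_coord j x (v : E x) : vdom j x ->
  v = \sum_b coord (vframe j x) b v *: tnth (vframe j x) b.
Proof.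
move=> jx; rewrite {1}(coord_basis (vframe_basis jx) (memvf v)).
by apply: eq_bigr => i _; rewrite (tnth_nth 0).
Qed.

Lemma dframe_coord j x (l : 'Hom(E x, R^o)) : vdom j x ->
  l = \sum_b (l (tnth (vframe j x) b) : R) *: dframe j b x.
Proof.
move=> jx; apply/lfunP => v; rewrite [in LHS](vframe_coord v jx).
rewrite linear_sum sum_lfunE; apply: eq_bigr => b _.
by rewrite linearZ /= scale_lfunE dframeE; exact: mulrC.
Qed.

Lemma dsmooth_sub U V a : V `<=` U -> dsmooth U a -> dsmooth V a.
Proof. by move=> VU sa j b; apply: smooth_sub (sa j b) => x []; split=> //; exact: VU. Qed.

Lemma open_vdomI j U : open U -> open (@vdom R m M E j `&` U).
Proof. by move=> oU; apply: openI => //; exact: vdom_open. Qed.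

Lemma dsmooth_ext U a s : open U -> (forall x, U x -> a x = s x) ->
  dsmooth U a -> dsmooth U s.
Proof.
move=> oU as_ sa j c; apply: smooth_ext (sa j c); first exact: open_vdomI.
by move=> x [_ Ux]; rewrite as_.
Qed.

Lemma dsmooth0 U : open U -> dsmooth U (fun x => 0 : 'Hom(E x, R^o)).
Proof.
move=> oU j b; apply: smooth_ext (smooth_cst _ 0); first exact: open_vdomI.
by move=> x _; rewrite zero_lfunE.
Qed.

Lemma dsmoothD U a s : open U -> dsmooth U a -> dsmooth U s ->
  dsmooth U (fun x => a x + s x).
Proof.
move=> oU sa ss j c; have oj := open_vdomI j oU.
by apply: smooth_ext (smooth_add oj (sa j c) (ss j c)) => // x _; rewrite add_lfunE.
Qed.

Lemma dsmoothZ U f a : open U -> smooth U f -> dsmooth U a ->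
  dsmooth U (fun x => f x *: a x).
Proof.
move=> oU sf sa j c; have oj := open_vdomI j oU.
have sf' : smooth (vdom j `&` U) f by apply: smooth_sub sf => x [].
by apply: smooth_ext (smooth_mul oj sf' (sa j c)) => // x _; rewrite scale_lfunE.
Qed.

Lemma dsmooth_sum U (I : Type) (r : seq I) (a : I -> dsection E) : open U ->
  (forall i, dsmooth U (a i)) -> dsmooth U (fun x => \sum_(i <- r) a i x).
Proof.
move=> oU sa; elim: r => [|i r IH].
  by apply: dsmooth_ext (dsmooth0 oU) => // x _; rewrite big_nil.
by apply: dsmooth_ext (dsmoothD oU (sa i) IH) => // x _; rewrite big_cons.
Qed.

Lemma dsmooth_dframe j b : dsmooth (vdom j) (dframe j b).
Proof.
move=> j' b'; rewrite setIC; apply: smooth_ext (vframe_smooth j j' b b').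
  by apply: openI; exact: vdom_open.
by move=> x _; rewrite dframeE.
Qed.

(** A covector is extended with constant coefficients in a dual frame. Identities between vectors at
    [x] can thus be tested on smooth local sections. *)
Lemma dsection_extend x (l : 'Hom(E x, R^o)) : exists U a,
  [/\ open U, U x, dsmooth U a & a x = l].
Proof.
have [j jx] := @vdom_cover R m M E x; have oj := @vdom_open R m M E j.
exists (vdom j), (fun y => \sum_b (l (tnth (vframe j x) b) : R) *: dframe j b y).
split=> //; last by rewrite -dframe_coord.
apply: dsmooth_sum => // b; apply: dsmoothZ => //; first exact: smooth_cst.
exact: dsmooth_dframe.
Qed.

End Bundle.

Context (E : VB2 M).
Implicit Types (U V : set M).

Lemma phi_dualE a b x (e : Et E x) : phi_dual a b x e = b x (phi E x e (a x)).
Proof.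
rewrite /phi_dual linfunE // => k u v.
by rewrite linearP /= add_lfunE scale_lfunE linearP.
Qed.

Lemma phi_dualxx a x : phi_dual (E:=E) a a x = 0.
Proof.
apply/lfunP => e; rewrite phi_dualE zero_lfunE wedge2_alt // -(phi_onto E x).
exact: memv_img (memvf e).
Qed.

Lemma phi_dual0l b x : phi_dual (E:=E) (fun=> 0) b x = 0.
Proof. by apply/lfunP => e; rewrite zero_lfunE !phi_dualE !linear0. Qed.

Lemma dsmooth_phi_dual U a b : open U -> dsmooth U a -> dsmooth U b ->
  dsmooth U (phi_dual (E:=E) a b).
Proof.
move=> oU sa sb j c.
apply: smooth_local => x [jx Ux]; have [i ix] := @vdom_cover R m M (E1 E) x.
exists (vdom i) => //; set D := _ `&` vdom i.
have oD : open D by apply: openI; [exact: open_vdomI|exact: vdom_open].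
have sub1 : D `<=` vdom i `&` U by move=> y [[]].
have sub2 : D `<=` vdom i `&` vdom j by move=> y [[]].
pose e y p := tnth (vframe i y) p.
(* These are the terms of the expansion of $b(\phi(e)(a))$ in local frames: a coefficient of $a$,
   one of $b$ and one of $\phi$. *)
have H p q : smooth D (fun y => a y (e y p) * (b y (e y q) *
    coord (vframe i y) q (phi E y (tnth (vframe j y) c) (dframe i p y)))).
  apply: smooth_mul => //; first by apply: smooth_sub sub1 _; exact: sa.
  apply: smooth_mul => //; first by apply: smooth_sub sub1 _; exact: sb.
  by apply: smooth_sub sub2 _; exact: phi_smooth.
apply: smooth_ext (smooth_sum (index_enum _) oD
  (fun p => smooth_sum (index_enum _) oD (H p))) => // y [[jy Uy] iy].
rewrite phi_dualE [in RHS](dframe_coord (a y) iy) !linear_sum.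
apply: eq_bigr => p _; rewrite !linearZ /= -mulr_sumr.
congr (_ * _); rewrite [in RHS](vframe_coord (phi E y _ _) iy) linear_sum.
by apply: eq_bigr => q _; rewrite linearZ /=; exact: mulrC.
Qed.

(* The image of a term in the truncation R + Γ_{E1^*} + Γ_{Et^*} of the quotient
   algebra to degrees at most 2, in which a product of degree-1 elements is
   already reduced by the ideal I. *)
Fixpoint tpart0 (t : term E) : M -> R :=
  match t with
  | Tfun f => f
  | Tone _ | Ttwo _ => fun=> 0
  | Tadd t u => fun x => tpart0 t x + tpart0 u x
  | Topp t => fun x => - tpart0 t x
  | Tmul t u => fun x => tpart0 t x * tpart0 u x
  end.

Fixpoint tpart1 (t : term E) : dsection (E1 E) :=
  match t with
  | Tone a => a
  | Tfun _ | Ttwo _ => fun=> 0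
  | Tadd t u => fun x => tpart1 t x + tpart1 u x
  | Topp t => fun x => - tpart1 t x
  | Tmul t u => fun x => tpart0 t x *: tpart1 u x + tpart0 u x *: tpart1 t x
  end.

Fixpoint tpart2 (t : term E) : dsection (Et E) :=
  match t with
  | Ttwo b => b
  | Tfun _ | Tone _ => fun=> 0
  | Tadd t u => fun x => tpart2 t x + tpart2 u x
  | Topp t => fun x => - tpart2 t x
  | Tmul t u => fun x => tpart0 t x *: tpart2 u x +
      (phi_dual (tpart1 t) (tpart1 u) x + tpart0 u x *: tpart2 t x)
  end.

Lemma tpart_smooth U (t : term E) : open U -> tsmooth U t ->
  [/\ smooth U (tpart0 t), dsmooth U (tpart1 t) & dsmooth U (tpart2 t)].
Proof.
move=> oU; elim: t => /=.
- by move=> f sf; split=> //; exact: dsmooth0.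
- by move=> a sa; split=> //; [exact: smooth_cst|exact: dsmooth0].
- by move=> b sb; split=> //; [exact: smooth_cst|exact: dsmooth0].
- move=> t IHt u IHu [/IHt[t0 t1 t2] /IHu[u0 u1 u2]].
  by split; [exact: smooth_add|exact: dsmoothD|exact: dsmoothD].
- move=> t IHt /IHt[t0 t1 t2]; split; first exact: smooth_opp.
  + apply: dsmooth_ext (dsmoothZ oU (smooth_cst U (-1)) t1) => // x _.
    by rewrite scaleN1r.
  + apply: dsmooth_ext (dsmoothZ oU (smooth_cst U (-1)) t2) => // x _.
    by rewrite scaleN1r.
- move=> t IHt u IHu [/IHt[t0 t1 t2] /IHu[u0 u1 u2]]; split.
  + exact: smooth_mul.
  + by apply: dsmoothD => //; exact: dsmoothZ.
  + apply: dsmoothD => //; first exact: dsmoothZ.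
    by apply: dsmoothD => //; [exact: dsmooth_phi_dual|exact: dsmoothZ].
Qed.

(** The truncated algebra satisfies every defining relation, so the three parts are invariants of
    the congruence. The check is made point by point and involves no smoothness. *)
Lemma teq_tpart U (t u : term E) : teq U t u -> forall x, U x ->
  [/\ tpart0 t x = tpart0 u x, tpart1 t x = tpart1 u x & tpart2 t x = tpart2 u x].
Proof.
(* Unfolded, [phi_dual] shows only the values of its arguments at [x], which the pointwise induction
   hypotheses can rewrite. *)
have pdE a b x : phi_dual (E:=E) a b x =
  linfun (fun e : Et E x => b x (phi E x e (a x))) by [].
have pdl a a' b x : phi_dual (E:=E) (fun y => a y + a' y) b x =
    phi_dual a b x + phi_dual a' b x.
  by apply/lfunP => e; rewrite add_lfunE !phi_dualE !linearD.
have pdr a b b' x : phi_dual (E:=E) a (fun y => b y + b' y) x =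
    phi_dual a b x + phi_dual a b' x.
  by apply/lfunP => e; rewrite add_lfunE !phi_dualE add_lfunE.
have pdZl (f : M -> R) a b x : phi_dual (E:=E) (fun y => f y *: a y) b x =
    f x *: phi_dual a b x.
  by apply/lfunP => e; rewrite scale_lfunE !phi_dualE !linearZ.
have pdZr (f : M -> R) a b x : phi_dual (E:=E) a (fun y => f y *: b y) x =
    f x *: phi_dual a b x.
  by apply/lfunP => e; rewrite scale_lfunE !phi_dualE scale_lfunE.
have pd0r a x : phi_dual (E:=E) a (fun=> 0) x = 0.
  by apply/lfunP => e; rewrite zero_lfunE !phi_dualE zero_lfunE.
pose simp := (phi_dualxx, phi_dual0l, pd0r, mulr0, mul0r, scaler0, scale0r, addr0, add0r).
move=> H; elim: {t u} H => /=; do ?by [].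
- by move=> t u _ IH x Ux; have [-> -> ->] := IH x Ux.
- by move=> t u v _ _ IH _ IH' x Ux; have [-> -> ->] := IH x Ux; exact: IH'.
- move=> t t' u u' _ IH _ IH' x Ux.
  by have [-> -> ->] := IH x Ux; have [-> -> ->] := IH' x Ux.
- by move=> t t' _ IH x Ux; have [-> -> ->] := IH x Ux.
- move=> t t' u u' _ IH _ IH' x Ux; rewrite !pdE.
  by have [-> -> ->] := IH x Ux; have [-> -> ->] := IH' x Ux.
- by move=> f g fg x Ux; rewrite fg.
- by move=> f g fg x Ux; rewrite fg.
- by move=> f g fg x Ux; rewrite fg.
- by move=> t u v x Ux; split; rewrite addrA.
- by move=> t u x Ux; split; rewrite addrC.
- by move=> t x Ux; split; rewrite add0r.
- by move=> t x Ux; split; rewrite addNr.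
(* Associativity: in degree 2 both bracketings give the same six terms, and the product of the three
   degree-1 parts, being of degree 3, is cut off. *)
- move=> t u v x Ux; split; first by rewrite mulrA.
    by rewrite !scalerDr !scalerA addrA mulrC; congr (_ + _ + _ *: _); rewrite mulrC.
  rewrite pdl pdr !pdZl !pdZr !scalerDr !scalerA !addrA [tpart0 v x * _]mulrC.
  by apply: eq_form => e; rewrite !(formD, formZ); ring.
- by move=> t x Ux; rewrite phi_dual0l mul1r !scale1r !scaler0 !addr0.
- move=> t u v x Ux; rewrite pdl mulrDl !scalerDl !scalerDr.
  by split=> //; [rewrite addrACA|rewrite -!addrA; apply: eq_form => e; rewrite !(formD, formZ); ring].
- move=> t u v x Ux; rewrite pdr mulrDr !scalerDl !scalerDr.
  by split=> //; [rewrite addrACA|apply: eq_form => e; rewrite !(formD, formZ); ring].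
- by move=> f g x Ux; rewrite ?simp.
- by move=> f g x Ux; rewrite ?simp.
- by move=> f t x Ux; rewrite ?simp mulrC.
- by move=> a b x Ux; rewrite ?simp.
- by move=> f a x Ux; rewrite ?simp.
- by move=> a b x Ux; rewrite ?simp.
- by move=> f a x Ux; rewrite ?simp.
- by move=> a x Ux; rewrite ?simp.
- by move=> b t x Ux; rewrite ?simp.
- by move=> a b x Ux; rewrite ?simp.
Qed.

End DualSections.

(** * Graded sections and terms *)

Section GradedSheaf.
Context (R : realType) (M : topologicalType) (C : gsheaf R M).
Context (U : set M) (oU : open U).
Implicit Types f g : C U.

Lemma gcomp0 k : gcomp k (0 : C U) = 0.
Proof. by apply: (addrI (gcomp k (0 : C U))); rewrite -gcompD // !addr0. Qed.

Lemma gcompN k f : gcomp k (- f) = - gcomp k f.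
Proof. by apply: (addrI (gcomp k f)); rewrite -gcompD // !subrr gcomp0. Qed.

Lemma ghom_gcomp k f : ghom k (gcomp k f).
Proof. by rewrite /ghom gcompI // eqxx. Qed.

Lemma gcomp_ghom k l f : ghom l f -> gcomp k f = if k == l then f else 0.
Proof. by move=> fl; rewrite -fl gcompI //. Qed.

Lemma ghom_ind (P : C U -> Prop) :
  P 0 -> (forall f g, P f -> P g -> P (f + g)) ->
  (forall k f, ghom k f -> P f) -> forall f, P f.
Proof.
move=> P0 PD Ph f; have [n ->] := gcomp_sum f oU.
by elim/big_ind: _ => // i _; apply: Ph (ghom_gcomp _ _).
Qed.

Lemma gcomp_mul_ind (H : forall f g, Prop) :
  (forall k f l g, ghom k f -> ghom l g -> H f g) ->
  (forall f, H f 0) -> (forall g, H 0 g) ->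
  (forall f g g', H f g -> H f g' -> H f (g + g')) ->
  (forall f f' g, H f g -> H f' g -> H (f + f') g) ->
  forall f g, H f g.
Proof.
move=> Hh H0r H0l HDr HDl f g.
elim/ghom_ind: f g => [//|f f' Hf Hf' g|k f fk]; first exact: HDl.
by elim/ghom_ind => [|g g'|l g gl]; [exact: H0r|exact: HDr|exact: Hh fk gl].
Qed.

(** By biadditivity the factors may be taken homogeneous, and then only pairs of degrees with the
    right sum survive; likewise in degrees 1 and 2 below. *)
Lemma gcomp_mul0 f g : gcomp 0 (f * g) = gcomp 0 f * gcomp 0 g.
Proof.
apply: (gcomp_mul_ind (H := fun f g => gcomp 0 (f * g) = gcomp 0 f * gcomp 0 g)).
- move=> k {}f l {}g fk gl; have := gcompM oU fk gl => fgkl.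
  rewrite (gcomp_ghom 0 fgkl) (gcomp_ghom 0 fk) (gcomp_ghom 0 gl).
  by case: k l {fk gl fgkl} => [|k] [|l] //=; rewrite ?(mul0r, mulr0).
- by move=> h; rewrite mulr0 gcomp0 mulr0.
- by move=> h; rewrite mul0r gcomp0 mul0r.
- by move=> h h1 h2 e1 e2; rewrite mulrDr !gcompD // e1 e2 mulrDr.
- by move=> h1 h2 h e1 e2; rewrite mulrDl !gcompD // e1 e2 mulrDl.
Qed.

Lemma gcomp_mul1 f g :
  gcomp 1 (f * g) = gcomp 0 f * gcomp 1 g + gcomp 1 f * gcomp 0 g.
Proof.
apply: (gcomp_mul_ind (H := fun f g => gcomp 1 (f * g) =
  gcomp 0 f * gcomp 1 g + gcomp 1 f * gcomp 0 g)).
- move=> k {}f l {}g fk gl; have := gcompM oU fk gl => fgkl.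
  rewrite (gcomp_ghom 1 fgkl) !(gcomp_ghom _ fk) !(gcomp_ghom _ gl).
  case: k l {fk gl fgkl} => [|[|k]] [|[|l]] //=;
  by rewrite ?(mul0r, mulr0, addr0, add0r).
- by move=> h; rewrite mulr0 !gcomp0 !mulr0 addr0.
- by move=> h; rewrite mul0r !gcomp0 !mul0r addr0.
- by move=> h h1 h2 e1 e2; rewrite mulrDr !gcompD // e1 e2 !mulrDr addrACA.
- by move=> h1 h2 h e1 e2; rewrite mulrDl !gcompD // e1 e2 !mulrDl addrACA.
Qed.

Lemma gcomp_mul2 f g : gcomp 2 (f * g) =
  gcomp 0 f * gcomp 2 g + (gcomp 1 f * gcomp 1 g + gcomp 2 f * gcomp 0 g).
Proof.
apply: (gcomp_mul_ind (H := fun f g => gcomp 2 (f * g) =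
  gcomp 0 f * gcomp 2 g + (gcomp 1 f * gcomp 1 g + gcomp 2 f * gcomp 0 g))).
- move=> k {}f l {}g fk gl; have := gcompM oU fk gl => fgkl.
  rewrite (gcomp_ghom 2 fgkl) !(gcomp_ghom _ fk) !(gcomp_ghom _ gl).
  case: k l {fk gl fgkl} => [|[|[|k]]] [|[|[|l]]] //=;
  by rewrite ?(mul0r, mulr0, addr0, add0r).
- by move=> h; rewrite mulr0 !gcomp0 !mulr0 !addr0.
- by move=> h; rewrite mul0r !gcomp0 !mul0r !addr0.
- move=> h h1 h2 e1 e2; rewrite mulrDr !gcompD // e1 e2 !mulrDr.
  by rewrite addrACA; congr (_ + _); rewrite addrACA.
- move=> h1 h2 h e1 e2; rewrite mulrDl !gcompD // e1 e2 !mulrDl.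
  by rewrite addrACA; congr (_ + _); rewrite addrACA.
Qed.

Lemma res0 V : open V -> V `<=` U -> res V (0 : C U) = 0 :> C V.
Proof.
by move=> oV VU; apply: (addrI (res V (0 : C U) : C V)); rewrite -resD // !addr0.
Qed.

Lemma resN V f : open V -> V `<=` U -> res V (- f) = - res V f.
Proof.
by move=> oV VU; apply: (addrI (res V f : C V)); rewrite -resD // !subrr res0.
Qed.

End GradedSheaf.

(** * Smooth functions as sections of degree 0 *)

Section FunctionSections.
Context (R : realType) (m0 m1 m2 : nat) (M : manifold R m0).
Context (CM : Nmanifold M m1 m2).
Implicit Types (U V : set M).

Lemma fun_secP U (h : M -> R) : open U -> smooth U h ->
  ghom 0 (fun_sec CM U h) /\ forall x, U x -> nval (fun_sec CM U h) x = h x.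
Proof. by move=> oU sh; exact: (xgetPex (0 : CM U) (nval_surj CM oU sh)). Qed.

Lemma fun_sec_eq U (s : CM U) (h : M -> R) : open U -> smooth U h ->
  ghom 0 s -> (forall x, U x -> nval s x = h x) -> s = fun_sec CM U h.
Proof.
move=> oU sh s0 sh'; have [f0 fh] := fun_secP oU sh.
by apply: nval_inj => // x Ux; rewrite sh' // fh.
Qed.

Lemma fun_sec_ext U (g h : M -> R) : open U -> smooth U g ->
  (forall x, U x -> g x = h x) -> fun_sec CM U g = fun_sec CM U h.
Proof.
move=> oU sg gh; have [g0 gg] := fun_secP oU sg.
apply: fun_sec_eq => //; first exact: smooth_ext gh sg.
by move=> x Ux; rewrite gg // gh.
Qed.

Lemma fun_secD U (g h : M -> R) : open U -> smooth U g -> smooth U h ->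
  fun_sec CM U (fun x => g x + h x) = fun_sec CM U g + fun_sec CM U h.
Proof.
move=> oU sg sh; have [g0 gg] := fun_secP oU sg; have [h0 hh] := fun_secP oU sh.
apply/esym/fun_sec_eq => //; first exact: smooth_add.
  by rewrite /ghom gcompD // g0 h0.
by move=> x Ux; rewrite nvalD // gg // hh.
Qed.

Lemma fun_secM U (g h : M -> R) : open U -> smooth U g -> smooth U h ->
  fun_sec CM U (fun x => g x * h x) = fun_sec CM U g * fun_sec CM U h.
Proof.
move=> oU sg sh; have [g0 gg] := fun_secP oU sg; have [h0 hh] := fun_secP oU sh.
apply/esym/fun_sec_eq => //; first exact: smooth_mul.
  by rewrite /ghom (gcompM (k:=0) (l:=0)).
by move=> x Ux; rewrite nvalM // gg // hh.
Qed.

Lemma fun_sec_cst U (a : R) : open U -> fun_sec CM U (fun=> a) = gcst CM U a.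
Proof.
move=> oU; apply/esym/fun_sec_eq => //; first exact: smooth_cst.
  exact: gcomp_cst.
by move=> x Ux; rewrite nval_cst.
Qed.

Lemma fun_sec0 U : open U -> fun_sec CM U (fun=> 0) = 0.
Proof. by move=> oU; rewrite fun_sec_cst // rmorph0. Qed.

Lemma fun_secN U (h : M -> R) : open U -> smooth U h ->
  fun_sec CM U (fun x => - h x) = - fun_sec CM U h.
Proof.
move=> oU sh; apply: (addIr (fun_sec CM U h)); rewrite addNr.
rewrite -fun_secD //; last exact: smooth_opp.
rewrite -[RHS](fun_sec0 oU); apply: fun_sec_ext => //.
  by apply: smooth_add => //; exact: smooth_opp.
by move=> x _; rewrite addNr.
Qed.

Lemma res_fun_sec U V (h : M -> R) : open U -> open V -> V `<=` U ->
  smooth U h -> res V (fun_sec CM U h) = fun_sec CM V h.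
Proof.
move=> oU oV VU sh; have [h0 hh] := fun_secP oU sh.
apply: fun_sec_eq => //; first exact: smooth_sub sh.
  by rewrite /ghom -res_gcomp // h0.
by move=> x Vx; rewrite nval_res // hh //; exact: VU.
Qed.

Lemma fun_sec_nval U (s : CM U) : open U -> ghom 0 s -> fun_sec CM U (nval s) = s.
Proof. by move=> oU s0; apply/esym/fun_sec_eq => //; exact: nval_smooth. Qed.

(** This is the number $f_0(x)$ of the Leibniz rule; at a fixed point it is a character of the
    stalk. *)
Definition nev U (f : CM U) (x : M) : R := nval (gcomp 0 f) x.

Lemma nevD U (f g : CM U) x : open U -> U x -> nev (f + g) x = nev f x + nev g x.
Proof. by move=> oU Ux; rewrite /nev gcompD // nvalD //; exact: ghom_gcomp. Qed.

Lemma nevM U (f g : CM U) x : open U -> U x -> nev (f * g) x = nev f x * nev g x.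
Proof. by move=> oU Ux; rewrite /nev gcomp_mul0 // nvalM //; exact: ghom_gcomp. Qed.

Lemma nev_cst U (a : R) x : open U -> U x -> nev (gcst CM U a) x = a.
Proof. by move=> oU Ux; rewrite /nev gcomp_cst // nval_cst. Qed.

Lemma nev_res U V (f : CM U) x : open U -> open V -> V `<=` U -> V x ->
  nev (res V f) x = nev f x.
Proof.
by move=> oU oV VU Vx; rewrite /nev -res_gcomp // nval_res //; exact: ghom_gcomp.
Qed.

Lemma nev0 U x : open U -> U x -> nev (0 : CM U) x = 0.
Proof. by move=> oU Ux; rewrite -(rmorph0 (gcst CM U)) nev_cst. Qed.

Lemma nev_ghom U k (f : CM U) x : open U -> U x -> ghom k.+1 f -> nev f x = 0.
Proof.
move=> oU Ux fk; have := nev0 oU Ux.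
by rewrite /nev (gcomp_ghom oU 0 fk) gcomp0.
Qed.

Lemma nev_fun_sec U (h : M -> R) x : open U -> U x -> smooth U h ->
  nev (fun_sec CM U h) x = h x.
Proof. by move=> oU Ux sh; have [h0 hh] := fun_secP oU sh; rewrite /nev h0 hh. Qed.

Lemma nev_smooth U (f : CM U) : open U -> smooth U (nev f).
Proof. by move=> oU; apply: nval_smooth => //; exact: ghom_gcomp. Qed.

End FunctionSections.

(** * Evaluation of terms in the structure sheaf *)

Section Terms.
Context (R : realType) (m0 m1 m2 : nat) (M : manifold R m0) (E : VB2 M).
Context (CM : Nmanifold M m1 m2) (cE : corresponds CM E).
Implicit Types (U V : set M).

Local Notation tev U t := (teval (CM := CM) (j1 cE U) (j2 cE U) t).

Lemma tsmooth_sub U V (t : term E) : V `<=` U -> tsmooth U t -> tsmooth V t.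
Proof.
move=> VU; elim: t => //=.
- by move=> f; exact: smooth_sub.
- by move=> f; exact: dsmooth_sub.
- by move=> f; exact: dsmooth_sub.
- by move=> t IHt u IHu [/IHt ? /IHu ?].
- by move=> t IHt u IHu [/IHt ? /IHu ?].
Qed.

Lemma teval_teq U (t u : term E) : open U -> tsmooth U t -> tsmooth U u ->
  teq U t u -> tev U t = tev U u.
Proof.
move=> oU st su tu; apply/(j_ker cE oU st su) => x Ux; exists U; split=> //.
Qed.

(** Equal sections come from terms that are congruent only locally, which is enough for a conclusion
    at one point. *)
Lemma teval_tpart U (t u : term E) x : open U -> U x -> tsmooth U t -> tsmooth U u ->
  tev U t = tev U u ->
  [/\ tpart0 t x = tpart0 u x, tpart1 t x = tpart1 u x & tpart2 t x = tpart2 u x].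
Proof.
move=> oU Ux st su /(j_ker cE oU st su)/(_ x Ux)[V [oV Vx VU tu]].
exact: teq_tpart tu x Vx.
Qed.

Lemma res_teval U V (t : term E) : open U -> open V -> V `<=` U -> tsmooth U t ->
  res V (tev U t) = tev V t.
Proof.
move=> oU oV VU; elim: t => /=.
- by move=> f; exact: res_fun_sec.
- by move=> f; exact: j1_res.
- by move=> f; exact: j2_res.
- by move=> t IHt u IHu [/IHt <- /IHu <-]; rewrite resD.
- by move=> t IHt /IHt <-; rewrite resN.
- by move=> t IHt u IHu [/IHt <- /IHu <-]; rewrite resM.
Qed.

(** Here and below, a relation of the congruence between smooth terms turns into an identity between
    sections of [CM]. *)
Lemma j1Z U f a : open U -> smooth U f -> dsmooth U a ->
  j1 cE U (fun x => f x *: a x) = fun_sec CM U f * j1 cE U a.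
Proof.
move=> oU sf sa.
apply: (@teval_teq U (Tone (fun x => f x *: a x)) (Tmul (Tfun f) (Tone a))) => //=.
  exact: dsmoothZ.
exact: teq_oneZ.
Qed.

Lemma j1D U a b : open U -> dsmooth U a -> dsmooth U b ->
  j1 cE U (fun x => a x + b x) = j1 cE U a + j1 cE U b.
Proof.
move=> oU sa sb.
apply: (@teval_teq U (Tone (fun x => a x + b x)) (Tadd (Tone a) (Tone b))) => //=.
  exact: dsmoothD.
exact: teq_oneD.
Qed.

Lemma j2Z U f a : open U -> smooth U f -> dsmooth U a ->
  j2 cE U (fun x => f x *: a x) = fun_sec CM U f * j2 cE U a.
Proof.
move=> oU sf sa.
apply: (@teval_teq U (Ttwo (fun x => f x *: a x)) (Tmul (Tfun f) (Ttwo a))) => //=.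
  exact: dsmoothZ.
exact: teq_twoZ.
Qed.

Lemma j2D U a b : open U -> dsmooth U a -> dsmooth U b ->
  j2 cE U (fun x => a x + b x) = j2 cE U a + j2 cE U b.
Proof.
move=> oU sa sb.
apply: (@teval_teq U (Ttwo (fun x => a x + b x)) (Tadd (Ttwo a) (Ttwo b))) => //=.
  exact: dsmoothD.
exact: teq_twoD.
Qed.

Lemma j2_phi U a b : open U -> dsmooth U a -> dsmooth U b ->
  j2 cE U (phi_dual a b) = j1 cE U a * j1 cE U b.
Proof.
move=> oU sa sb.
apply: (@teval_teq U (Ttwo (phi_dual a b)) (Tmul (Tone a) (Tone b))) => //=.
  exact: dsmooth_phi_dual.
exact: teq_phi.
Qed.

Lemma j1_ext U a b : open U -> dsmooth U a -> (forall x, U x -> a x = b x) ->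
  j1 cE U a = j1 cE U b.
Proof.
move=> oU sa ab; apply: (@teval_teq U (Tone a) (Tone b)) => //=.
  exact: dsmooth_ext sa.
exact: teq_one_ext.
Qed.

Lemma j2_ext U a b : open U -> dsmooth U a -> (forall x, U x -> a x = b x) ->
  j2 cE U a = j2 cE U b.
Proof.
move=> oU sa ab; apply: (@teval_teq U (Ttwo a) (Ttwo b)) => //=.
  exact: dsmooth_ext sa.
exact: teq_two_ext.
Qed.

Lemma j1_0 U : open U -> j1 cE U (fun x => 0) = 0.
Proof.
move=> oU; have s0 := dsmooth0 (E:=E1 E) oU.
apply: (addrI (j1 cE U (fun x => 0))); rewrite -j1D // addr0.
apply: j1_ext => //; first exact: dsmoothD.
by move=> x _; rewrite addr0.
Qed.

Lemma j2_0 U : open U -> j2 cE U (fun x => 0) = 0.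
Proof.
move=> oU; have s0 := dsmooth0 (E:=Et E) oU.
apply: (addrI (j2 cE U (fun x => 0))); rewrite -j2D // addr0.
apply: j2_ext => //; first exact: dsmoothD.
by move=> x _; rewrite addr0.
Qed.

Lemma j1N U a : open U -> dsmooth U a -> j1 cE U (fun x => - a x) = - j1 cE U a.
Proof.
move=> oU sa; rewrite -mulN1r -(rmorph1 (gcst CM U)) -rmorphN -fun_sec_cst //.
rewrite -j1Z //; last exact: smooth_cst.
apply/esym/j1_ext => // [|x _]; last by rewrite scaleN1r.
by apply: dsmoothZ => //; exact: smooth_cst.
Qed.

Lemma j2N U a : open U -> dsmooth U a -> j2 cE U (fun x => - a x) = - j2 cE U a.
Proof.
move=> oU sa; rewrite -mulN1r -(rmorph1 (gcst CM U)) -rmorphN -fun_sec_cst //.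
rewrite -j2Z //; last exact: smooth_cst.
apply/esym/j2_ext => // [|x _]; last by rewrite scaleN1r.
by apply: dsmoothZ => //; exact: smooth_cst.
Qed.

Lemma ghom0_comm U k (f g : CM U) : open U -> ghom 0 f -> ghom k g -> f * g = g * f.
Proof. by move=> oU f0 gk; rewrite (gcomm oU f0 gk) mul0n expr0 mul1r. Qed.

Lemma gcomp_teval U (t : term E) : open U -> tsmooth U t ->
  [/\ gcomp 0 (tev U t) = fun_sec CM U (tpart0 t),
      gcomp 1 (tev U t) = j1 cE U (tpart1 t) &
      gcomp 2 (tev U t) = j2 cE U (tpart2 t)].
Proof.
move=> oU; elim: t => /=.
- move=> f sf; have [f0 _] := fun_secP CM oU sf.
  by rewrite !(gcomp_ghom oU _ f0) /= j1_0 // j2_0.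
- move=> a sa; have a1 := j1_deg cE oU sa.
  by rewrite !(gcomp_ghom oU _ a1) /= fun_sec0 // j2_0.
- move=> a sa; have a1 := j2_deg cE oU sa.
  by rewrite !(gcomp_ghom oU _ a1) /= fun_sec0 // j1_0.
- move=> t IHt u IHu [st su]; have [t0 t1 t2] := IHt st; have [u0 u1 u2] := IHu su.
  have [st0 st1 st2] := tpart_smooth oU st; have [su0 su1 su2] := tpart_smooth oU su.
  by rewrite !gcompD // t0 t1 t2 u0 u1 u2 fun_secD // j1D // j2D.
- move=> t IHt st; have [t0 t1 t2] := IHt st.
  have [st0 st1 st2] := tpart_smooth oU st.
  by rewrite !gcompN // t0 t1 t2 fun_secN // j1N // j2N.
- move=> t IHt u IHu [st su]; have [t0 t1 t2] := IHt st; have [u0 u1 u2] := IHu su.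
  have [st0 st1 st2] := tpart_smooth oU st; have [su0 su1 su2] := tpart_smooth oU su.
  have [fu _] := fun_secP CM oU su0.
  have sj1 := j1_deg cE oU st1; have sj2 := j2_deg cE oU st2.
  rewrite gcomp_mul0 // gcomp_mul1 // gcomp_mul2 // t0 t1 t2 u0 u1 u2 fun_secM //.
  (* The truncation writes function coefficients on the left, so the degree-0 component of the right
     factor is moved across. *)
  rewrite -(ghom0_comm oU fu sj1) -(ghom0_comm oU fu sj2) -j2_phi // -!j1Z // -!j2Z //.
  rewrite -j1D //; [|exact: dsmoothZ|exact: dsmoothZ].
  rewrite -j2D //; [|exact: dsmooth_phi_dual|exact: dsmoothZ].
  rewrite -j2D //; first exact: dsmoothZ.
  by apply: dsmoothD => //; [exact: dsmooth_phi_dual|exact: dsmoothZ].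
Qed.

End Terms.

(** * Tangent vectors as point derivations *)

Section PointDerivations.
Context (R : realType) (m0 m1 m2 : nat) (M : manifold R m0).
Context (CM : Nmanifold M m1 m2) (x : M).
Implicit Types (U V : set M) (X Y : forall U : set M, CM U -> R).

(* Since [nev] vanishes in positive degree, the sign in the graded Leibniz rule
   is invisible: a homogeneous tangent vector of any degree is a plain point
   derivation. *)
Record point_derivation X : Prop := {
  pd_lin : forall U (a : R) (f g : CM U), open U -> U x ->
    X U (gcst CM U a * f + g) = a * X U f + X U g;
  pd_res : forall U V (f : CM U), open U -> open V -> V `<=` U -> V x ->
    X V (res V f) = X U f;
  pd_mul : forall U (f g : CM U), open U -> U x ->
    X U (f * g) = X U f * nev g x + nev f x * X U g
}.

Lemma pd_add X U (f g : CM U) : point_derivation X -> open U -> U x ->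
  X U (f + g) = X U f + X U g.
Proof.
move=> pX oU Ux; have := pd_lin pX 1 f g oU Ux.
by rewrite rmorph1 !mul1r.
Qed.

Lemma pd0 X U : point_derivation X -> open U -> U x -> X U 0 = 0.
Proof.
by move=> pX oU Ux; apply: (addrI (X U 0)); rewrite -pd_add // !addr0.
Qed.

Lemma pd_opp X U (f : CM U) : point_derivation X -> open U -> U x ->
  X U (- f) = - X U f.
Proof.
move=> pX oU Ux; apply: (addrI (X U f)).
by rewrite -pd_add // !subrr pd0.
Qed.

Lemma htangent_point_derivation p X : is_htangent x p X -> point_derivation X.
Proof.
move=> hX.
have XD U (f g : CM U) : open U -> U x -> X U (f + g) = X U f + X U g.
  move=> oU Ux; have := ht_lin hX 1 f g oU Ux.
  by rewrite rmorph1 !mul1r.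
have X0 U : open U -> U x -> X U 0 = 0.
  by move=> oU Ux; apply: (addrI (X U 0)); rewrite -XD // !addr0.
split; [exact: ht_lin hX|exact: ht_res hX|] => U f g oU Ux.
elim/(@ghom_ind R M CM U oU): f => [|f f' Hf Hf'|k f fk].
- by rewrite mul0r X0 // nev0 // !mul0r addr0.
- by rewrite mulrDl !XD // nevD // Hf Hf' !mulrDl addrACA.
- rewrite (ht_leibniz hX g oU Ux fk); congr (_ + _).
  case: k fk => [|k] fk; first by rewrite mulr0 expr0z mul1r.
  by have := nev_ghom oU Ux fk; rewrite /nev => ->; rewrite mulr0 !mul0r.
Qed.

Lemma point_derivation_htangent p X : point_derivation X ->
  (forall U k (f : CM U), open U -> U x -> ghom k f -> k%:Z + p != 0 -> X U f = 0) ->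
  is_htangent x p X.
Proof.
move=> pX dX; split=> //; [exact: pd_lin|exact: pd_res|] => U k f g oU Ux fk.
rewrite pd_mul //; congr (_ + _).
case: k fk => [|k] fk; first by rewrite mulr0 expr0z mul1r.
by have := nev_ghom oU Ux fk; rewrite /nev => ->; rewrite mulr0 !mul0r.
Qed.

Lemma tangent_point_derivation X : is_tangent x X -> point_derivation X.
Proof.
move=> [n [p [Y [hY XE]]]].
have pY i := htangent_point_derivation (hY i); split.
- move=> U a f g oU Ux; rewrite !XE // mulr_sumr -big_split /=.
  by apply: eq_bigr => i _; exact: pd_lin.
- move=> U V f oU oV VU Vx; rewrite !XE //; last exact: VU.
  by apply: eq_bigr => i _; exact: pd_res.
- move=> U f g oU Ux; rewrite !XE // mulr_suml mulr_sumr -big_split /=.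
  by apply: eq_bigr => i _; exact: pd_mul.
Qed.

(** [X] acts on sections over open sets, a derivation on total functions: some neighbourhood where
    [f] is smooth is chosen, and compatibility with restrictions makes the choice irrelevant. The
    default 0 is reached only when [f] is not smooth near [x]. *)
Definition base_derivation X (f : M -> R) : R :=
  xget 0 [set r | exists U, [/\ open U, U x, smooth U f & r = X U (fun_sec CM U f)]].

Lemma base_derivationE X U f : point_derivation X -> open U -> U x -> smooth U f ->
  base_derivation X f = X U (fun_sec CM U f).
Proof.
move=> pX oU Ux sf; rewrite /base_derivation; set S := [set r | _].
have : S (xget 0 S) by apply: xgetPex; exists (X U (fun_sec CM U f)); exists U.
move=> [V [oV Vx sf' ->]].
have oW : open (U `&` V) by exact: openI.
have WU : U `&` V `<=` U by move=> y [].
have WV : U `&` V `<=` V by move=> y [].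
by rewrite -(pd_res pX (fun_sec CM V f) oV oW WV) // res_fun_sec //
  -(pd_res pX (fun_sec CM U f) oU oW WU) // res_fun_sec.
Qed.

Lemma smooth_at2 f g : smooth_at x f -> smooth_at x g ->
  exists U, [/\ open U, U x, smooth U f & smooth U g].
Proof.
move=> [U [oU Ux sf]] [V [oV Vx sg]]; exists (U `&` V); split=> //.
- exact: openI.
- by apply: smooth_sub sf => y [].
- by apply: smooth_sub sg => y [].
Qed.

Lemma base_derivationP X : point_derivation X -> is_derivation x (base_derivation X).
Proof.
move=> pX; split.
- move=> f g xf xg fg; have [U [oU Ux sf sg]] := smooth_at2 xf xg.
  have [V [oV Vx] VE] : exists2 V, open_nbhs x V & V `<=` [set y | f y = g y].
    by move: fg; rewrite /prop_near1 nbhsE.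
  have oW : open (U `&` V) by exact: openI.
  have WU : U `&` V `<=` U by move=> y [].
  rewrite !(@base_derivationE X (U `&` V)) //; try exact: (smooth_sub WU).
  congr (X _ _); apply: fun_sec_ext => //; first exact: (smooth_sub WU).
  by move=> y [_]; exact: VE.
- move=> a f g xf xg; have [U [oU Ux sf sg]] := smooth_at2 xf xg.
  have sa := smooth_cst U a; have saf := smooth_mul oU sa sf.
  have sag := smooth_add oU saf sg.
  by rewrite !(@base_derivationE X U) // fun_secD // fun_secM // fun_sec_cst // pd_lin.
- move=> f g xf xg; have [U [oU Ux sf sg]] := smooth_at2 xf xg.
  have sfg := smooth_mul oU sf sg.
  by rewrite !(@base_derivationE X U) // fun_secM // pd_mul // !nev_fun_sec.
Qed.

Lemma is_derivation0 : is_derivation x (fun=> 0 : R).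
Proof. by split=> // *; rewrite ?(mulr0, mul0r, addr0). Qed.

Lemma derivation_eq0 (D : (M -> R) -> R) U f : is_derivation x D -> open U -> U x ->
  (forall y, U y -> f y = 0) -> D f = 0.
Proof.
move=> dD oU Ux f0.
have s0 : smooth_at x (fun=> 0 : R) by exists U; split=> //; exact: smooth_cst.
have sf : smooth_at x f.
  exists U; split=> //; apply: smooth_ext (smooth_cst U 0) => //.
  by move=> y /f0.
have -> : D f = D (fun=> 0).
  apply: (der_germ dD) => //; apply: (filterS f0).
  exact: open_nbhs_nbhs.
(* Linearity with coefficient $-1$, applied to the zero function twice, gives $D(0)=0$. *)
transitivity (-1 * D (fun=> 0) + D (fun=> 0)); last by rewrite mulN1r addNr.
rewrite -(der_lin dD _ s0 s0); congr (D _).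
by apply/funext => y; rewrite mulr0 addr0.
Qed.

Context (E : VB2 M) (cE : corresponds CM E).
Local Notation tev U t := (teval (CM := CM) (j1 cE U) (j2 cE U) t).

(** Near [x] every section is the value of a term in the generators, and both sides obey the same
    rules for sums, opposites and products. *)
Lemma point_derivation_eq X Y : point_derivation X -> point_derivation Y ->
  (forall U f, open U -> U x -> smooth U f ->
     X U (fun_sec CM U f) = Y U (fun_sec CM U f)) ->
  (forall U a, open U -> U x -> dsmooth U a -> X U (j1 cE U a) = Y U (j1 cE U a)) ->
  (forall U b, open U -> U x -> dsmooth U b -> X U (j2 cE U b) = Y U (j2 cE U b)) ->
  forall U (f : CM U), open U -> U x -> X U f = Y U f.
Proof.
move=> pX pY H0 H1 H2 U f oU Ux.
have [V [oV Vx VU [t st ft]]] := j_onto cE f oU Ux.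
rewrite -(pd_res pX f oU oV VU Vx) -(pd_res pY f oU oV VU Vx) ft.
elim: t st {ft} => /=.
- by move=> g; exact: H0.
- by move=> a; exact: H1.
- by move=> b; exact: H2.
- by move=> t IHt u IHu [/IHt Ht /IHu Hu]; rewrite !pd_add // Ht Hu.
- by move=> t IHt /IHt Ht; rewrite !pd_opp // Ht.
- by move=> t IHt u IHu [/IHt Ht /IHu Hu]; rewrite !pd_mul // Ht Hu.
Qed.

(* A point derivation is function-linear on generators of positive degree, so it
   is determined there by its values on a dual frame. *)
Lemma point_derivation_vector X (B : vbundle M)
    (j : forall U, dsection B -> CM U) :
  point_derivation X ->
  (forall U a, open U -> U x -> dsmooth U a -> nev (j U a) x = 0) ->
  (forall U V a, open U -> open V -> V `<=` U -> dsmooth U a ->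
    res V (j U a) = j V a) ->
  (forall U a b, open U -> dsmooth U a -> (forall y, U y -> a y = b y) ->
    j U a = j U b) ->
  (forall U a b, open U -> dsmooth U a -> dsmooth U b ->
    j U (fun y => a y + b y) = j U a + j U b) ->
  (forall U f a, open U -> smooth U f -> dsmooth U a ->
    j U (fun y => f y *: a y) = fun_sec CM U f * j U a) ->
  exists v : B x, forall U a, open U -> U x -> dsmooth U a -> X U (j U a) = a x v.
Proof.
move=> pX nevj jres jext jD jZ; have [i ix] := @vdom_cover R m0 M B x.
have oi := @vdom_open R m0 M B i; have sF b := dsmooth_dframe i b.
exists (\sum_b X _ (j (vdom i) (dframe i b)) *: tnth (vframe i x) b).
move=> U a oU Ux sa; have oW := openI oU oi.
have WU : U `&` vdom i `<=` U by move=> y [].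
have Wi : U `&` vdom i `<=` vdom i by move=> y [].
rewrite -(pd_res pX _ oU oW WU) // jres // linear_sum /=.
have sFW b : dsmooth (U `&` vdom i) (dframe i b) := dsmooth_sub Wi (sF b).
have sc b : smooth (U `&` vdom i) (fun y => a y (tnth (vframe i y) b)).
  by rewrite setIC; exact: sa.
have sZ b := dsmoothZ oW (sc b) (sFW b).
have s0 := dsmooth0 (E:=B) oW.
have j0 : j (U `&` vdom i) (fun=> 0) = 0.
  apply: (addrI (j (U `&` vdom i) (fun=> 0))); rewrite -jD // addr0.
  by apply: jext => //; [exact: dsmoothD|move=> y _; rewrite addr0].
have -> : j (U `&` vdom i) a = \sum_b
    fun_sec CM (U `&` vdom i) (fun y => a y (tnth (vframe i y) b)) *
    j (U `&` vdom i) (dframe i b).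
  transitivity (j (U `&` vdom i) (fun y => \sum_b
      (a y (tnth (vframe i y) b) : R) *: dframe i b y)).
    apply: jext => //; first exact: dsmooth_sub sa.
    by move=> y [_ iy]; exact: dframe_coord.
  elim: (index_enum _) => [|b r IH].
    rewrite big_nil -[RHS]j0; apply: jext => // [|y _]; first exact: dsmooth_sum.
    by rewrite big_nil.
  rewrite big_cons -IH -jZ // -jD //; last exact: dsmooth_sum.
  apply: jext => // [|y _]; first exact: dsmooth_sum.
  by rewrite big_cons.
elim/big_ind2: _ => [|f r g s <- <-|b _]; [exact: pd0|exact: pd_add|].
rewrite pd_mul // linearZ /= nev_fun_sec // nevj // mulr0 add0r mulrC.
by rewrite -(jres _ _ _ oi oW Wi (sF b)) (pd_res pX _ oi oW Wi).
Qed.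

Lemma point_derivation_vector1 X : point_derivation X ->
  exists v : E1 E x, forall U a, open U -> U x -> dsmooth U a ->
    X U (j1 cE U a) = a x v.
Proof.
move=> pX; apply: point_derivation_vector => //.
- by move=> U a oU Ux sa; exact: (nev_ghom oU Ux (j1_deg cE oU sa)).
- by move=> U V a; exact: j1_res.
- by move=> U a b; exact: j1_ext.
- by move=> U a b; exact: j1D.
- by move=> U f a; exact: j1Z.
Qed.

Lemma point_derivation_vector2 X : point_derivation X ->
  exists2 u : Et E x, u \in lker (phi E x) & forall U b, open U -> U x ->
    dsmooth U b -> X U (j2 cE U b) = b x u.
Proof.
move=> pX; have [|||||u uE] := @point_derivation_vector X (Et E) (j2 cE) pX.
- by move=> U a oU Ux sa; exact: (nev_ghom oU Ux (j2_deg cE oU sa)).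
- by move=> U V a; exact: j2_res.
- by move=> U a b; exact: j2_ext.
- by move=> U a b; exact: j2D.
- by move=> U f a; exact: j2Z.
(* The vanishing of $\phi(u)$ is tested on pairs of covectors, extended to local sections whose
   product the derivation kills. *)
exists u => //; rewrite memv_ker; apply/eqP/lfunP => a; rewrite zero_lfunE.
apply: separating_dual => b.
have [U [a' [oU Ux sa <-]]] := dsection_extend a.
have [V [b' [oV Vx sb <-]]] := dsection_extend b.
have oW := openI oU oV.
have {}sa : dsmooth (U `&` V) a' by apply: dsmooth_sub sa => y [].
have {}sb : dsmooth (U `&` V) b' by apply: dsmooth_sub sb => y [].
rewrite -phi_dualE -(uE (U `&` V)) //; last exact: dsmooth_phi_dual.
rewrite j2_phi // pd_mul //.
rewrite (nev_ghom oW _ (j1_deg cE oW sa)) // (nev_ghom oW _ (j1_deg cE oW sb)) //.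
by rewrite mulr0 mul0r addr0.
Qed.

(** The value is read off the truncation of any term representing [f] near [x]. Such a term exists
    by [j_onto] whenever [U] is an open neighbourhood of [x], so the default 0 does not occur
    there. *)
Definition split_tangent (D : (M -> R) -> R) (v : E1 E x) (u : Et E x) U (f : CM U) : R :=
  xget 0 [set r | exists V t, [/\ open V, V x, V `<=` U &
    [/\ tsmooth V t, res V f = tev V t &
     r = D (tpart0 t) + (tpart1 t x v : R) + (tpart2 t x u : R)]]].

(** * The tangent vector with prescribed components *)

Section SplitTangent.
Context (D : (M -> R) -> R) (v : E1 E x) (u : Et E x).
Context (dD : is_derivation x D) (phi_u : u \in lker (phi E x)).

(** Two terms representing [f] have the same value on the intersection of their domains, hence the
    same truncation at each of its points. *)
Lemma split_tangentE U V (f : CM U) t : open U -> open V -> V x -> V `<=` U ->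
  tsmooth V t -> res V f = tev V t ->
  split_tangent D v u f = D (tpart0 t) + (tpart1 t x v : R) + (tpart2 t x u : R).
Proof.
move=> oU oV Vx VU st ft; rewrite /split_tangent; set S := [set r | _].
have : S (xget 0 S) by apply: xgetPex; eexists; exists V, t.
move=> [V' [t' [oV' Vx' VU' [st' ft' ->]]]].
have oW := openI oV oV'.
have WV : V `&` V' `<=` V by move=> y [].
have WV' : V `&` V' `<=` V' by move=> y [].
have sW := tsmooth_sub WV st; have sW' := tsmooth_sub WV' st'.
have tt' : tev (V `&` V') t' = tev (V `&` V') t.
  by rewrite -(res_teval cE oV oW WV st) -(res_teval cE oV' oW WV' st') -ft -ft' !res_comp.
have Wx : (V `&` V') x by [].
have [_ -> ->] := teval_tpart oW Wx sW' sW tt'.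
congr (_ + _ + _); apply: (der_germ dD).
- by exists (V `&` V'); split=> //; have [] := tpart_smooth oW sW'.
- by exists (V `&` V'); split=> //; have [] := tpart_smooth oW sW.
(* In degrees 1 and 2 agreement at [x] suffices, but [D] depends on the germ, so the degree-0 parts
   must agree on a neighbourhood. *)
have DE : V `&` V' `<=` [set y | tpart0 t' y = tpart0 t y].
  by move=> y Wy; have [] := teval_tpart oW Wy sW' sW tt'.
by apply: (filterS DE); exact: open_nbhs_nbhs.
Qed.

Lemma split_tangent_fun U f : open U -> U x -> smooth U f ->
  split_tangent D v u (fun_sec CM U f) = D f.
Proof.
move=> oU Ux sf; rewrite (@split_tangentE U U _ (Tfun f)) //=; last exact: res_id.
by rewrite !zero_lfunE !addr0.
Qed.

Lemma split_tangent_j1 U a : open U -> U x -> dsmooth U a ->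
  split_tangent D v u (j1 cE U a) = a x v.
Proof.
move=> oU Ux sf; rewrite (@split_tangentE U U _ (Tone a)) //=; last exact: res_id.
by rewrite zero_lfunE addr0 (derivation_eq0 dD oU Ux) // add0r.
Qed.

Lemma split_tangent_j2 U b : open U -> U x -> dsmooth U b ->
  split_tangent D v u (j2 cE U b) = b x u.
Proof.
move=> oU Ux sf; rewrite (@split_tangentE U U _ (Ttwo b)) //=; last exact: res_id.
by rewrite zero_lfunE addr0 (derivation_eq0 dD oU Ux) // add0r.
Qed.

Lemma nev_tpart U V (f : CM U) t y : open U -> open V -> V y -> V `<=` U ->
  tsmooth V t -> res V f = tev V t -> nev f y = tpart0 t y.
Proof.
move=> oU oV Vy VU st ft; rewrite -(nev_res f oU oV VU Vy) ft /nev.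
have [-> _ _] := gcomp_teval cE oV st; have [s0 _ _] := tpart_smooth oV st.
by have [_ ->] := fun_secP CM oV s0.
Qed.

Lemma split_tangentP : point_derivation (split_tangent D v u).
Proof.
have common U (f g : CM U) : open U -> U x -> exists V t t',
    [/\ open V, V x, V `<=` U & [/\ tsmooth V t, tsmooth V t',
    res V f = tev V t & res V g = tev V t']].
  move=> oU Ux; have [V [oV Vx VU [t st ft]]] := j_onto cE f oU Ux.
  have [V' [oV' Vx' VU' [t' st' ft']]] := j_onto cE g oU Ux.
  have oW := openI oV oV'.
  have WV : V `&` V' `<=` V by move=> y [].
  have WV' : V `&` V' `<=` V' by move=> y [].
  exists (V `&` V'), t, t'; split=> //; first by move=> y /WV /VU.
  split; [exact: tsmooth_sub st|exact: tsmooth_sub st'| |].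
    by rewrite -(res_teval cE oV oW WV st) -ft res_comp.
  by rewrite -(res_teval cE oV' oW WV' st') -ft' res_comp.
split.
- move=> U a f g oU Ux; have [V [t [t' [oV Vx VU [st st' ft gt]]]]] := common U f g oU Ux.
  rewrite (split_tangentE oU oV Vx VU st ft) (split_tangentE oU oV Vx VU st' gt).
  have sat := smooth_cst V a.
  rewrite (@split_tangentE U V _ (Tadd (Tmul (Tfun (fun=> a)) t) t')) //=; last first.
    by rewrite resD // resM // res_cst // ft gt fun_sec_cst.
  have [t0 _ _] := tpart_smooth oV st; have [t0' _ _] := tpart_smooth oV st'.
  have xt0 : smooth_at x (tpart0 t) by exists V.
  have xt0' : smooth_at x (tpart0 t') by exists V.
  transitivity ((a * D (tpart0 t) + D (tpart0 t')) +
    (a * (tpart1 t x v : R) + (tpart1 t' x v : R)) +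
    (a * (tpart2 t x u : R) + (tpart2 t' x u : R))); last by ring.
  congr (_ + _ + _); first exact: (der_lin dD a xt0 xt0').
    by rewrite scaler0 addr0 add_lfunE scale_lfunE.
  by rewrite phi_dual0l scaler0 !addr0 add_lfunE scale_lfunE.
- move=> U V f oU oV VU Vx.
  have [W [oW Wx WV [t st ft]]] := j_onto cE (res V f) oV Vx.
  rewrite (split_tangentE oV oW Wx WV st ft) (@split_tangentE U W _ t) //.
    by move=> y /WV /VU.
  by rewrite -ft res_comp.
- move=> U f g oU Ux; have [V [t [t' [oV Vx VU [st st' ft gt]]]]] := common U f g oU Ux.
  rewrite (split_tangentE oU oV Vx VU st ft) (split_tangentE oU oV Vx VU st' gt).
  rewrite (nev_tpart oU oV Vx VU st ft) (nev_tpart oU oV Vx VU st' gt).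
  rewrite (@split_tangentE U V _ (Tmul t t')) //=; last by rewrite resM // ft gt.
  have [t0 _ _] := tpart_smooth oV st; have [t0' _ _] := tpart_smooth oV st'.
  have xt0 : smooth_at x (tpart0 t) by exists V.
  have xt0' : smooth_at x (tpart0 t') by exists V.
  transitivity ((D (tpart0 t) * tpart0 t' x + tpart0 t x * D (tpart0 t')) +
    (tpart0 t x * (tpart1 t' x v : R) + tpart0 t' x * (tpart1 t x v : R)) +
    (tpart0 t x * (tpart2 t' x u : R) + tpart0 t' x * (tpart2 t x u : R)));
    last by ring.
  congr (_ + _ + _); first exact: (der_leibniz dD xt0 xt0').
    by rewrite add_lfunE !scale_lfunE.
  (* The product of the two degree-1 parts contributes the one term that is foreign to the Leibniz
     rule; it vanishes because [u] lies in the kernel of [phi]. *)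
  rewrite !add_lfunE !scale_lfunE phi_dualE.
  by move: phi_u; rewrite memv_ker => /eqP ->; rewrite zero_lfunE linear0 add0r.
Qed.

End SplitTangent.

Lemma split_tangent_is_tangent D v u : is_derivation x D -> u \in lker (phi E x) ->
  is_tangent x (split_tangent D v u).
Proof.
move=> dD pu; have d0 := is_derivation0.
have p0 : 0 \in lker (phi E x) := mem0v _.
(* A tangent vector of degree $p$ lives on sections of degree $-p$: functions, sections of $E_1^*$
   and sections of $\tilde E^*$ give 0, $-1$, $-2$. *)
exists 3, (fun i => match val i with 0 => 0 | 1 => -1 | _ => -2%:Z end).
exists (fun i => match val i with
  | 0 => split_tangent D 0 0
  | 1 => split_tangent (fun=> 0) v 0
  | _ => split_tangent (fun=> 0) 0 u end).
split=> [[[|[|[|//]]] /= _]|U f oU Ux].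
- apply: point_derivation_htangent; first exact: split_tangentP.
  move=> U [|k] f oU Ux fk // _.
  have [V [oV Vx VU [t st ft]]] := j_onto cE f oU Ux.
  rewrite (split_tangentE _ _ _ oU oV Vx VU st ft) // !linear0 !addr0.
  apply: (derivation_eq0 dD oV Vx) => y Vy.
  by rewrite -(nev_tpart oU oV Vy VU st ft) (nev_ghom oU _ fk) //; exact: VU.
- apply: point_derivation_htangent; first exact: split_tangentP.
  move=> U k f oU Ux fk k1.
  have [V [oV Vx VU [t st ft]]] := j_onto cE f oU Ux.
  rewrite (split_tangentE _ _ _ oU oV Vx VU st ft) // linear0 addr0 add0r.
  have [_ s1 _] := tpart_smooth oV st.
  have [_ t1 _] := gcomp_teval cE oV st.
  (* For [f] of degree other than 1 the component of degree 1 is zero; invariance of the truncation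
     brings this back from sections to the covector at [x]. *)
  have eq0 : tev V (Tone (tpart1 t)) = tev V (Tone (fun=> 0)).
    rewrite /= j1_0 // -t1 -ft -res_gcomp // (gcomp_ghom oU 1 fk).
    by rewrite ifF ?res0 //; apply: contraNF k1 => /eqP <-.
  have [_ /= -> _] := teval_tpart oV Vx (t := Tone (tpart1 t)) (u := Tone (fun=> 0))
    s1 (dsmooth0 oV) eq0.
  by rewrite zero_lfunE.
- apply: point_derivation_htangent; first exact: split_tangentP.
  move=> U k f oU Ux fk k1.
  have [V [oV Vx VU [t st ft]]] := j_onto cE f oU Ux.
  rewrite (split_tangentE _ _ _ oU oV Vx VU st ft) // linear0 addr0 add0r.
  have [_ _ s2] := tpart_smooth oV st.
  have [_ _ t2] := gcomp_teval cE oV st.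
  have eq0 : tev V (Ttwo (tpart2 t)) = tev V (Ttwo (fun=> 0)).
    rewrite /= j2_0 // -t2 -ft -res_gcomp // (gcomp_ghom oU 2 fk).
    by rewrite ifF ?res0 //; apply: contraNF k1 => /eqP <-.
  have [_ _ /= ->] := teval_tpart oV Vx (t := Ttwo (tpart2 t)) (u := Ttwo (fun=> 0))
    s2 (dsmooth0 oV) eq0.
  by rewrite zero_lfunE.
- have [V [oV Vx VU [t st ft]]] := j_onto cE f oU Ux.
  rewrite !big_ord_recl big_ord0 /=.
  rewrite !(split_tangentE _ _ _ oU oV Vx VU st ft) // !linear0.
  by rewrite !(addr0, add0r) addrA.
Qed.

End PointDerivations.

(** * The tangent map *)

Section Morphism.
Context (R : realType) (m0 m1 m2 n0 n1 n2 : nat).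
Context (M : manifold R m0) (N : manifold R n0).
Context (CM : Nmanifold M m1 m2) (CN : Nmanifold N n1 n2) (Psi : Nmor CM CN).
Local Notation psi := (nbase Psi).

Lemma nbase_open V : open V -> open (psi @^-1` V).
Proof. by move=> oV; have [/continuousP cP _] := nbase_smooth Psi; exact: cP. Qed.

(* Otherwise f - (psi^# f)(x) would be invertible near psi x, while its pullback
   vanishes at x. *)
Lemma nev_npull V (f : CN V) x : open V -> V (psi x) ->
  nev (npull Psi f) x = nev f (psi x).
Proof.
move=> oV Vx; have oV' := nbase_open oV; set b := nev (npull Psi f) x.
apply/eqP; rewrite eq_sym; apply: contraT => fb.
pose h := f - gcst CN V b; have hE y : V y -> nev h y = nev f y - b.
  by move=> Vy; rewrite /h -rmorphN nevD // nev_cst.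
have sh := nev_smooth h oV.
pose W := V `&` [set y | nev h y != 0].
have oW : open W.
  rewrite openE => y [Vy hy]; apply: filterI; first exact: open_nbhs_nbhs.
  exact: (cvgr_neq0 (nev h y) (smooth_cont oV sh Vy) hy).
have WV : W `<=` V by move=> y [].
have Wx : W (psi x) by split=> //=; rewrite hE // subr_eq0.
have shW : smooth W (nev h) by exact: smooth_sub sh.
have sk : smooth W (fun y => (nev h y)^-1) by apply: smooth_inv => // y [].
pose g := res W (gcomp 0 h) : CN W.
have gk : g * fun_sec CN W (fun y => (nev h y)^-1) = gcst CN W 1.
  rewrite /g -{1}(fun_sec_nval oV (ghom_gcomp oV 0 h)) (res_fun_sec _ oV) // -fun_secM //.
  rewrite -fun_sec_cst //; apply: fun_sec_ext => //; first exact: smooth_mul.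
  by move=> y [_ hy]; rewrite mulfV.
have oW' := nbase_open oW.
have := congr1 (fun s => nev (npull Psi s) x) gk.
rewrite /= npullM // npull_cst // nevM // nev_cst // /g npull_res // npull_gcomp //.
rewrite nev_res //; last by move=> y; exact: WV.
have -> : nev (gcomp 0 (npull Psi h)) x = 0.
  rewrite /nev gcompI //= -/(nev _ x) /h -rmorphN npullD // npull_cst // nevD // nev_cst //.
  by rewrite subrr.
by rewrite mul0r => /esym/eqP; rewrite oner_eq0.
Qed.

(** Smoothness of the composite is obtained from the sheaf, as the value function of a degree-0
    section, rather than from a chain rule in charts. *)
Lemma npull_fun_sec V f : open V -> smooth V f ->
  smooth (psi @^-1` V) (f \o psi) /\
  npull Psi (fun_sec CN V f) = fun_sec CM (psi @^-1` V) (f \o psi).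
Proof.
move=> oV sf; have oV' := nbase_open oV; have [f0 ff] := fun_secP CN oV sf.
have p0 : ghom 0 (npull Psi (fun_sec CN V f)) by rewrite /ghom -npull_gcomp // f0.
have fE y : V (psi y) -> nval (npull Psi (fun_sec CN V f)) y = f (psi y).
  move=> Vy; rewrite -[X in nval X]p0 -/(nev _ y) nev_npull //.
  exact: nev_fun_sec.
have sp : smooth (psi @^-1` V) (f \o psi).
  by apply: smooth_ext (nval_smooth oV' p0).
by split=> //; exact: fun_sec_eq.
Qed.

Lemma point_derivation_npull x (X : forall U, CM U -> R) :
  point_derivation x X ->
  point_derivation (psi x) (fun V (f : CN V) => X _ (npull Psi f)).
Proof.
move=> pX; split.
- move=> V a f g oV Vx; have oV' := nbase_open oV.
  by rewrite npullD // npullM // npull_cst // (pd_lin pX).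
- move=> V W f oV oW WV Wx; rewrite npull_res //.
  by apply: (pd_res pX) => //; [exact: nbase_open|exact: nbase_open|move=> y; exact: WV].
- move=> V f g oV Vx; have oV' := nbase_open oV.
  by rewrite npullM // (pd_mul pX) // !nev_npull.
Qed.

Context (E : VB2 M) (F : VB2 N).
Context (cE : corresponds CM E) (cF : corresponds CN F).
Context (h : VB2_mor E F psi) (Psi_h : given_by cE cF h).

Lemma psi2E x (u : E2 E x) : vsval (psi2 h x u) = psit h x (vsval u).
Proof.
rewrite /psi2 linfunE; last by move=> k v w; rewrite !linearP.
rewrite vsprojK // memv_ker -psi_phi.
have := subvsP u; rewrite memv_ker => /eqP ->.
by rewrite /wedge2_map comp_lfun0l comp_lfun0r.
Qed.

(** This is the tangent map in components. [X] is described only by its values on generators, so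
    that both an arbitrary point derivation and a [split_tangent] fit. *)
Lemma npull_generators x (X : forall U, CM U -> R) (D : (M -> R) -> R)
    (v : E1 E x) (u : Et E x) :
  (forall U f, open U -> U x -> smooth U f -> X U (fun_sec CM U f) = D f) ->
  (forall U a, open U -> U x -> dsmooth U a -> X U (j1 cE U a) = a x v) ->
  (forall U b, open U -> U x -> dsmooth U b -> X U (j2 cE U b) = b x u) ->
  [/\ forall V f, open V -> V (psi x) -> smooth V f ->
        X _ (npull Psi (fun_sec CN V f)) = D (f \o psi),
      forall V a, open V -> V (psi x) -> dsmooth V a ->
        X _ (npull Psi (j1 cF V a)) = a (psi x) (psi1 h x v) &
      forall V b, open V -> V (psi x) -> dsmooth V b ->
        X _ (npull Psi (j2 cF V b)) = b (psi x) (psit h x u)].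
Proof.
move=> X0 X1 X2; have [h1 h2] := Psi_h; split.
- move=> V f oV Vx sf; have [sp ->] := npull_fun_sec oV sf.
  by rewrite X0 //; exact: nbase_open.
- move=> V a oV Vx sa; have [sp ->] := h1 V a oV sa.
  by rewrite X1 //; [rewrite comp_lfunE|exact: nbase_open].
- move=> V a oV Vx sa; have [sp ->] := h2 V a oV sa.
  by rewrite X2 //; [rewrite comp_lfunE|exact: nbase_open].
Qed.

Lemma eq_on_dsections (B : vbundle N) y (v w : B y) :
  (forall V a, open V -> V y -> dsmooth V a -> a y v = a y w) -> v = w.
Proof.
move=> H; apply/eqP; rewrite -subr_eq0; apply/eqP/separating_dual => l.
have [V [a [oV Vy sa <-]]] := dsection_extend l.
by rewrite linearB /= (H V a) // subrr.
Qed.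

(** Surjectivity is applied to the target vector $(0,w,0)$. A preimage may have further components,
    but comparison on sections of $F_1^*$ sees only the one in $E_1$; the next two lemmas use
    $(0,0,w)$ and $(D',0,0)$ in the same way. *)
Lemma Nregular_value_psi1 c x : Nregular_value Psi c -> psi x = c ->
  forall w, exists v, psi1 h x v = w.
Proof.
move=> reg xc w; have d0 := is_derivation0 (psi x).
have k0 : 0 \in lker (phi F (psi x)) := mem0v _.
have [X tX XE] := reg x xc _ (split_tangent_is_tangent cF w d0 k0).
have pX := tangent_point_derivation tX.
have [v vE] := point_derivation_vector1 cE pX.
have [u _ uE] := point_derivation_vector2 cE pX.
have [_ H _] := npull_generators
  (fun U f oU Ux sf => esym (base_derivationE pX oU Ux sf)) vE uE.
exists v; apply: eq_on_dsections => V a oV Vx sa.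
by rewrite -(H V a) // XE // split_tangent_j1.
Qed.

Lemma Nregular_value_psi2 c x : Nregular_value Psi c -> psi x = c ->
  forall w, exists v, psi2 h x v = w.
Proof.
move=> reg xc w; have d0 := is_derivation0 (psi x).
have [X tX XE] := reg x xc _ (split_tangent_is_tangent cF 0 d0 (subvsP w)).
have pX := tangent_point_derivation tX.
have [v vE] := point_derivation_vector1 cE pX.
have [u ku uE] := point_derivation_vector2 cE pX.
have [_ _ H] := npull_generators
  (fun U f oU Ux sf => esym (base_derivationE pX oU Ux sf)) vE uE.
(* The component [u] is known to lie in the kernel of [phi], so it is an element of [E2] and the
   projection leaves it unchanged. *)
exists (vsproj _ u); apply: val_inj; rewrite /= psi2E vsprojK //.
apply: eq_on_dsections => V a oV Vx sa.
by rewrite -(H V a) // XE // split_tangent_j2 // subvsP.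
Qed.

Lemma Nregular_value_base c : Nregular_value Psi c -> regular_value psi c.
Proof.
move=> reg x xc D' dD'.
have k0 : 0 \in lker (phi F (psi x)) := mem0v _.
have [X tX XE] := reg x xc _ (split_tangent_is_tangent cF 0 dD' k0).
have pX := tangent_point_derivation tX.
exists (base_derivation x X); first exact: base_derivationP.
move=> f [V [oV Vx sf]]; have [sp pE] := npull_fun_sec oV sf.
rewrite (base_derivationE pX (nbase_open oV)) // -pE XE //.
exact: split_tangent_fun.
Qed.

(** The three components of [Y] are lifted independently and reassembled; the lift is compared with
    [Y] on generators alone. *)
Lemma Nregular_value_split c : regular_value psi c ->
  (forall x, psi x = c -> (forall w, exists v, psi1 h x v = w) /\
                          (forall w, exists v, psi2 h x v = w)) ->
  Nregular_value Psi c.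
Proof.
move=> reg sur x xc Y /tangent_point_derivation pY.
have [sur1 sur2] := sur x xc.
have [v' vE'] := point_derivation_vector1 cF pY.
have [u' ku' uE'] := point_derivation_vector2 cF pY.
have [D dD DE] := reg x xc _ (base_derivationP pY).
have [v vv'] := sur1 v'; have [u uu'] := sur2 (vsproj _ u').
have {}uu' : psit h x (vsval u) = u' by rewrite -psi2E uu' vsprojK.
have ku := subvsP u.
exists (split_tangent cE D v (vsval u)); first exact: split_tangent_is_tangent.
have [H0 H1 H2] := npull_generators (split_tangent_fun cE v (vsval u) dD)
  (split_tangent_j1 cE v (vsval u) dD) (split_tangent_j2 cE v (vsval u) dD).
have pX := point_derivation_npull (split_tangentP cE v dD ku).
refine (point_derivation_eq (cE := cF) pX pY _ _ _).
- move=> V f oV Vx sf; rewrite H0 // -(base_derivationE pY oV) //.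
  by apply: DE; exists V.
- by move=> V a oV Vx sa; rewrite H1 // vv' vE'.
- by move=> V b oV Vx sb; rewrite H2 // uu' uE'.
Qed.

End Morphism.

Theorem lemma2p25 (R : realType) (m0 m1 m2 n0 n1 n2 : nat)
  (M : manifold R m0) (N : manifold R n0)
  (E : VB2 M) (F : VB2 N)
  (CM : Nmanifold M m1 m2) (CN : Nmanifold N n1 n2)
  (cE : corresponds CM E) (cF : corresponds CN F)
  (Psi : Nmor CM CN)
  (h : VB2_mor E F (nbase Psi)) (Psi_h : given_by cE cF h)
  (c : N) :
  (Nregular_value Psi c <->
     regular_value (nbase Psi) c /\
     (forall x, nbase Psi x = c ->
        (forall w, exists v, psi1 h x v = w) /\
        (forall w, exists v, psi2 h x v = w))) /\
  ((forall x, nbase Psi x = c ->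
      (forall w, exists v, psi1 h x v = w) /\
      (forall w, exists v, psi2 h x v = w)) <->
   (forall x, nbase Psi x = c ->
      injective (dual_map (psi1 h x)) /\ injective (dual_map (psi2 h x)))).
Proof.
split; first split=> [reg|[reg sur]].
- split; first exact: (Nregular_value_base cF reg).
  move=> x xc; split; first exact: (Nregular_value_psi1 Psi_h reg xc).
  exact: (Nregular_value_psi2 Psi_h reg xc).
- exact: (Nregular_value_split Psi_h reg sur).
- split=> H x xc; have [H1 H2] := H x xc; split; exact/surjective_dual_map.
Qed.
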